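(* Let $H$ be a quasi-Hopf algebra, $B$ an associative algebra and $v:H\to B$ an algebra map. Then the maps $$\psi:B^v\# H\to B\otimes H,\qquad \psi(b\# h)=v(X^1x^1_1)\,b\,v(S(X^2x^1_2)\alpha X^3x^2h_1)\otimes x^3h_2,$$ $$\xi:B\otimes H\to B^v\# H,\qquad \xi(b\otimes h)=v(z^1)\,b\,v(Z^1\beta S(z^2h_1Z^2))\,\#\,z^3h_2Z^3,$$ are inverse to each other, providing thus an algebra isomorphism $B^v\# H\simeq B\otimes H$ (where $B\otimes H$ is the usual tensor product of algebras).
   Context: Throughout, $k$ is a field, all algebras and linear spaces are over $k$, $\otimes=\otimes_k$. A quasi-bialgebra $(H,\Delta,\varepsilon,\Phi)$ is a unital associative algebra $H$ with algebra maps $\Delta:H\to H\otimes H$, $\varepsilon:H\to k$ and an invertible $\Phi\in H^{\otimes 3}$ such that for all $h\in H$: $(id\otimes\Delta)(\Delta(h))=\Phi(\Delta\otimes id)(\Delta(h))\Phi^{-1}$; $(id\otimes\varepsilon)(\Delta(h))=h=(\varepsilon\otimes id)(\Delta(h))$; $(1\otimes\Phi)(id\otimes\Delta\otimes id)(\Phi)(\Phi\otimes 1)=(id\otimes id\otimes\Delta)(\Phi)(\Delta\otimes id\otimes id)(\Phi)$; $(\varepsilon\otimes id\otimes id)(\Phi)=(id\otimes\varepsilon\otimes id)(\Phi)=(id\otimes id\otimes\varepsilon)(\Phi)=1\otimes 1$. Notation (summation understood): $\Delta(h)=h_1\otimes h_2$; $\Phi=X^1\otimes X^2\otimes X^3=Z^1\otimes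 Z^2\otimes Z^3=\cdots$ and $\Phi^{-1}=x^1\otimes x^2\otimes x^3=z^1\otimes z^2\otimes z^3=\cdots$ (different letters denote independent copies); lower indices denote components of $\Delta$, e.g. $\Delta(x^1)=x^1_1\otimes x^1_2$. A quasi-Hopf algebra is a quasi-bialgebra $H$ with an algebra anti-automorphism $S$ and $\alpha,\beta\in H$ such that $S(h_1)\alpha h_2=\varepsilon(h)\alpha$, $h_1\beta S(h_2)=\varepsilon(h)\beta$ for all $h$, $X^1\beta S(X^2)\alpha X^3=1$, $S(x^1)\alpha x^2\beta S(x^3)=1$; normalised (as one may) so that $\varepsilon(\alpha)=\varepsilon(\beta)=1$ and $\varepsilon\circ S=\varepsilon$. A left $H$-module algebra is a left $H$-module $A$ with a multiplication and (usual) unit $1_A$ such that $(aa')a''=(X^1\cdot a)[(X^2\cdot a')(X^3\cdot a'')]$, $h\cdot(aa')=(h_1\cdot a)(h_2\cdot a')$, $h\cdot 1_A=\varepsilon(h)1_A$. The smash product $A\# H$ is $A\otimes H$ (elements written $a\# h$) with the associative multiplication $(a\# h)(a'\# h')=(x^1\cdot a)(x^2h_1\cdot a')\# x^3h_2h'$ and unit $1_A\# 1$. $B^v$ is the left $H$-module algebra with underlying space $B$, multiplication $b\star b'=v(X^1)bv(S(x^1X^2)\alpha x^2X^3_1)b'v(S(x^3X^3_2))$, unit $v(\beta)$, and action $h\triangleright_v b=v(h_1)bv(S(h_2))$. *)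

(* Defs.v *)
From HB Require Import structures.
From mathcomp Require Import all_boot all_order all_algebra.
From mathcomp Require Import boolp.

Set Implicit Arguments.
Unset Strict Implicit.
Unset Printing Implicit Defensive.

Import GRing.Theory.
Local Open Scope ring_scope.
Local Open Scope quotient_scope.

(* The structure algType of the library forces 1 != 0.  Here an algebra is    *)
(* associative and unital, and may be zero; its ring structure is then the    *)
(* library's pzRingType.                                                      *)
HB.mixin Record Lmodule_isPzAlgebra (k : pzRingType) A of GRing.Lmodule k A := {
  pzalg_one : A;
  pzalg_mul : A -> A -> A;
  pzalg_mulA : associative pzalg_mul;
  pzalg_mul1l : left_id pzalg_one pzalg_mul;
  pzalg_mul1r : right_id pzalg_one pzalg_mul;
  pzalg_mulDl : left_distributive pzalg_mul +%R;
  pzalg_mulDr : right_distributive pzalg_mul +%R;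
  pzalg_scaleAl : forall (a : k) x y,
    a *: pzalg_mul x y = pzalg_mul (a *: x) y;
  pzalg_scaleAr : forall (a : k) x y,
    a *: pzalg_mul x y = pzalg_mul x (a *: y)
}.

#[short(type="pzAlgType")]
HB.structure Definition PzAlgebra (k : pzRingType) :=
  { A of Lmodule_isPzAlgebra k A & GRing.Lmodule k A }.

Section PzAlgebraRing.
Variables (k : pzRingType) (A : pzAlgType k).

HB.instance Definition _ := GRing.Zmodule_isPzRing.Build (PzAlgebra.sort A)
  (@pzalg_mulA k A) (@pzalg_mul1l k A) (@pzalg_mul1r k A)
  (@pzalg_mulDl k A) (@pzalg_mulDr k A).

Lemma pzscalerAl (a : k) (x y : A) : a *: (x * y) = (a *: x) * y.
Proof. exact: pzalg_scaleAl. Qed.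

Lemma pzscalerAr (a : k) (x y : A) : a *: (x * y) = x * (a *: y).
Proof. exact: pzalg_scaleAr. Qed.

End PzAlgebraRing.

Section AlgebraMaps.
Variable k : fieldType.

Definition algebra_map (A B : pzAlgType k) (f : A -> B) : Prop :=
  linear f /\ monoid_morphism f.

Definition anti_automorphism (A : pzAlgType k) (f : A -> A) : Prop :=
  [/\ linear f, f 1 = 1, {morph f : x y / x * y >-> y * x} & bijective f].

(* The axioms of a unital associative algebra for operations which are not    *)
(* packed into a pzAlgType.                                                   *)
Definition is_algebra (A : lmodType k) (mul : A -> A -> A) (one : A) : Prop :=
  [/\ associative mul, left_id one mul, right_id one mul
    & bilinear_for *:%R *:%R mul].

End AlgebraMaps.

(* The tensor product of two k-spaces: finite formal sums of pairs, two sums  *)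
(* being equal when every bilinear map takes the same value on them.          *)
Section Tensor.
Variables (k : fieldType) (U V : lmodType k).

Definition bsum (W : zmodType) (F : U -> V -> W) (s : seq (U * V)) : W :=
  \sum_(p <- s) F p.1 p.2.

Definition tens_rel (s t : seq (U * V)) : bool :=
  `[< forall (W : lmodType k) (F : {bilinear U -> V -> W}),
        bsum F s = bsum F t >].

Fact tens_rel_equiv : equiv_class_of tens_rel.
Proof.
split=> [s|s t|t s u].
- exact/asboolP.
- by apply/asboolP/asboolP => h W F; rewrite h.
- by move=> /asboolP h1 /asboolP h2; apply/asboolP => W F; rewrite h1 h2.
Qed.

Definition tens_equiv := EquivRelPack tens_rel_equiv.

Definition tensor : Type := {eq_quot tens_equiv}.

HB.instance Definition _ := Choice.on tensor.
HB.instance Definition _ := EqQuotient.on tensor.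

Lemma tens_eqP (s t : seq (U * V)) :
  (forall (W : lmodType k) (F : {bilinear U -> V -> W}),
     bsum F s = bsum F t) <-> \pi_tensor s = \pi_tensor t.
Proof.
split=> [h|/eqmodP/asboolP //].
by apply/eqmodP/asboolP.
Qed.

Lemma bsum_repr (s : seq (U * V)) (W : lmodType k)
  (F : {bilinear U -> V -> W}) : bsum F (repr (\pi_tensor s)) = bsum F s.
Proof. by move: W F; apply/tens_eqP; rewrite reprK. Qed.

Definition tens0 : tensor := \pi_tensor [::].
Definition tens_add (x y : tensor) : tensor := \pi_tensor (repr x ++ repr y).
Definition tens_scale (a : k) (x : tensor) : tensor :=
  \pi_tensor [seq (a *: p.1, p.2) | p <- repr x].
Definition tens_opp (x : tensor) : tensor := tens_scale (-1) x.

Lemma bsum_cat (W : zmodType) (F : U -> V -> W) s t :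
  bsum F (s ++ t) = bsum F s + bsum F t.
Proof. exact: big_cat. Qed.

Lemma bsum_scale (W : lmodType k) (F : {bilinear U -> V -> W}) a s :
  bsum F [seq (a *: p.1, p.2) | p <- s] = a *: bsum F s.
Proof.
rewrite /bsum big_map scaler_sumr; apply: eq_bigr => p _ /=.
exact: linearZl_LR.
Qed.

Lemma tens_ext (x y : tensor) :
  (forall (W : lmodType k) (F : {bilinear U -> V -> W}),
     bsum F (repr x) = bsum F (repr y)) -> x = y.
Proof. by move=> h; rewrite -[x]reprK -[y]reprK; apply/tens_eqP. Qed.

Fact tens_addA : associative tens_add.
Proof.
by move=> x y z; apply: tens_ext => W F; rewrite !(bsum_repr, bsum_cat) addrA.
Qed.
Fact tens_addC : commutative tens_add.
Proof.
by move=> x y; apply: tens_ext => W F; rewrite !(bsum_repr, bsum_cat) addrC.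
Qed.
Fact tens_add0 : left_id tens0 tens_add.
Proof.
move=> x; apply: tens_ext => W F; rewrite !(bsum_repr, bsum_cat).
by rewrite {1}/bsum big_nil add0r.
Qed.
Fact tens_addN : left_inverse tens0 tens_opp tens_add.
Proof.
move=> x; apply: tens_ext => W F.
rewrite !(bsum_repr, bsum_cat, bsum_scale) scaleN1r addNr.
by rewrite /bsum big_nil.
Qed.

HB.instance Definition _ :=
  GRing.isZmodule.Build tensor tens_addA tens_addC tens_add0 tens_addN.

Fact tens_scaleA a b x : tens_scale a (tens_scale b x) = tens_scale (a * b) x.
Proof.
by apply: tens_ext => W F; rewrite !(bsum_repr, bsum_scale) scalerA.
Qed.
Fact tens_scale1 : left_id 1 tens_scale.
Proof.
by move=> x; apply: tens_ext => W F; rewrite !(bsum_repr, bsum_scale) scale1r.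
Qed.
Fact tens_scaleDr : right_distributive tens_scale +%R.
Proof.
move=> a x y; apply: tens_ext => W F.
by rewrite !(bsum_repr, bsum_scale, bsum_cat) scalerDr.
Qed.
Fact tens_scaleDl x : {morph tens_scale^~ x : a b / a + b}.
Proof.
move=> a b; apply: tens_ext => W F.
by rewrite !(bsum_repr, bsum_scale, bsum_cat) scalerDl.
Qed.

HB.instance Definition _ := GRing.Zmodule_isLmodule.Build k tensor
  tens_scaleA tens_scale1 tens_scaleDr tens_scaleDl.

Definition tens (u : U) (v : V) : tensor := \pi_tensor [:: (u, v)].

Lemma bsum1 (W : zmodType) (F : U -> V -> W) u v : bsum F [:: (u, v)] = F u v.
Proof. exact: big_seq1. Qed.

Lemma tens_bilinear : bilinear_for *:%R *:%R tens.
Proof.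
split=> [v|u] a x y; apply: tens_ext => W F.
  rewrite !(bsum_repr, bsum_scale, bsum_cat) !bsum1.
  by rewrite linearPl.
rewrite !(bsum_repr, bsum_scale, bsum_cat) !bsum1.
by rewrite linearPr.
Qed.

(* The map on the tensor product induced by F.  It is evaluated on a chosen   *)
(* representative, so that F need not come with a proof of bilinearity; when  *)
(* F is bilinear, it is the unique linear map extending F, see tlift_tens,    *)
(* tlift_linear and tens_eq_linear.                                           *)
Definition tlift (W : zmodType) (x : tensor) (F : U -> V -> W) : W :=
  bsum F (repr x).

Section Lift.
Variables (W : lmodType k) (F : U -> V -> W).
Hypothesis F_bilinear : bilinear_for *:%R *:%R F.

Let F' : U -> V -> W := F.
HB.instance Definition _ :=
  bilinear_isBilinear.Build k U V W *:%R *:%R F' F_bilinear.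

Lemma tlift_tens u v : tlift (tens u v) F = F u v.
Proof. by rewrite /tlift -/F' bsum_repr bsum1. Qed.

Lemma tlift_linear : linear (fun x => tlift x F).
Proof.
by move=> a x y; rewrite /tlift -/F' !(bsum_repr, bsum_scale, bsum_cat).
Qed.

End Lift.

Lemma tens_sum (x : tensor) : x = \sum_(p <- repr x) tens p.1 p.2.
Proof.
have aux s : \pi_tensor s = \sum_(p <- s) tens p.1 p.2.
  elim: s => [|[u v] s IHs]; first by rewrite big_nil.
  rewrite big_cons -IHs; apply: tens_ext => W F.
  by rewrite !(bsum_repr, bsum_cat) -bsum_cat.
by rewrite -{1}[x]reprK aux.
Qed.

Lemma tens_eq_linear (W : lmodType k) (f g : tensor -> W) :
  linear f -> linear g -> (forall u v, f (tens u v) = g (tens u v)) -> f =1 g.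
Proof.
move=> fL gL fg x.
pose f' : {linear tensor -> W} :=
  HB.pack f (GRing.isLinear.Build k tensor W *:%R f fL).
pose g' : {linear tensor -> W} :=
  HB.pack g (GRing.isLinear.Build k tensor W *:%R g gL).
rewrite -[f x]/(f' x) -[g x]/(g' x) (tens_sum x) !linear_sum.
by apply: eq_bigr => p _; apply: fg.
Qed.

End Tensor.

Arguments tens {k U V} u v.
Arguments tlift {k U V W} x F.

Declare Scope tensor_scope.
Delimit Scope tensor_scope with T.
Local Open Scope tensor_scope.

Reserved Notation "u ⊗ v" (at level 41, right associativity).
Notation "U ⊗ V" := (tensor U%type V%type) : type_scope.
Notation "u ⊗ v" := (tens u v) : tensor_scope.

(* Sweedler notation: the sum of the values of E over the components of t,    *)
(* which is a ⊗ b, respectively a ⊗ b ⊗ c, summation understood.              *)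
Notation "\tsum_ ( a , b <- t ) E" := (tlift t (fun a b => E))
  (at level 36, a name, b name, t at level 50, E at level 41,
   right associativity,
   format "'[' \tsum_ ( a ,  b  <-  t ) '/  '  E ']'") : ring_scope.
Notation "\tsum_ ( a , b , c <- t ) E" :=
  (tlift t (fun a u => tlift u (fun b c => E)))
  (at level 36, a name, b name, c name, t at level 50, E at level 41,
   right associativity,
   format "'[' \tsum_ ( a ,  b ,  c  <-  t ) '/  '  E ']'") : ring_scope.

Section TensorTheory.
Variables (k : fieldType) (U V : lmodType k).

Lemma tens_ind (P : U ⊗ V -> Prop) :
  P 0 -> (forall x y, P x -> P y -> P (x + y)) ->
  (forall u v, P (u ⊗ v)) -> forall x, P x.
Proof.
by move=> P0 PD PT x; rewrite [x]tens_sum; elim/big_ind: _ => // p _; apply: PT.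
Qed.

Lemma eq_tlift (W : zmodType) (F G : U -> V -> W) x :
  (forall u v, F u v = G u v) -> tlift x F = tlift x G.
Proof. by move=> FG; apply: eq_bigr => p _. Qed.

Lemma tlift_fun_linear (W : lmodType k) (F G : U -> V -> W) a x :
  tlift x (fun u v => a *: F u v + G u v) = a *: tlift x F + tlift x G.
Proof. by rewrite /tlift /bsum big_split scaler_sumr. Qed.

Lemma tensDl (u u' : U) (v : V) : (u + u') ⊗ v = u ⊗ v + u' ⊗ v.
Proof.
by have := (tens_bilinear U V).1 v 1 u u'; rewrite /= !scale1r.
Qed.

Lemma tensDr (u : U) (v v' : V) : u ⊗ (v + v') = u ⊗ v + u ⊗ v'.
Proof.
by have := (tens_bilinear U V).2 u 1 v v'; rewrite /= !scale1r.
Qed.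

Lemma tens0l (v : V) : (0 : U) ⊗ v = 0.
Proof. by apply: (addrI ((0 : U) ⊗ v)); rewrite -tensDl !addr0. Qed.

Lemma tens0r (u : U) : u ⊗ (0 : V) = 0.
Proof. by apply: (addrI (u ⊗ (0 : V))); rewrite -tensDr !addr0. Qed.

Lemma tensZl a (u : U) (v : V) : (a *: u) ⊗ v = a *: (u ⊗ v).
Proof.
by have := (tens_bilinear U V).1 v a u 0; rewrite /= !addr0 tens0l addr0.
Qed.

Lemma tensZr a (u : U) (v : V) : u ⊗ (a *: v) = a *: (u ⊗ v).
Proof.
by have := (tens_bilinear U V).2 u a v 0; rewrite /= !addr0 tens0r addr0.
Qed.

End TensorTheory.

Section TensorAlgebra.
Variables (k : fieldType) (A B : pzAlgType k).

Definition tens_mul (x y : A ⊗ B) : A ⊗ B :=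
  \tsum_(a, b <- x) \tsum_(a', b' <- y) (a * a') ⊗ (b * b').

Fact tens_mul_bilinear_in (a : A) (b : B) :
  bilinear_for *:%R *:%R (fun (a' : A) (b' : B) => (a * a') ⊗ (b * b')).
Proof.
by split=> [v|u] c x y /=;
  rewrite mulrDr -pzscalerAr ?tensDl ?tensZl ?tensDr ?tensZr.
Qed.

Fact tens_mul_bilinear_out (y : A ⊗ B) : bilinear_for *:%R *:%R
  (fun (a : A) (b : B) => \tsum_(a', b' <- y) (a * a') ⊗ (b * b')).
Proof.
by split=> [v|u] c x z /=; rewrite -tlift_fun_linear; apply: eq_tlift => a' b';
  rewrite mulrDl -pzscalerAl ?tensDl ?tensZl ?tensDr ?tensZr.
Qed.

Lemma tens_mul_bilinear : bilinear_for *:%R *:%R tens_mul.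
Proof.
split=> [y|x] c u v; first exact: tlift_linear (tens_mul_bilinear_out y) c u v.
rewrite /tens_mul -tlift_fun_linear; apply: eq_tlift => a b.
exact: tlift_linear (tens_mul_bilinear_in a b) c u v.
Qed.

Lemma tens_mulE a b a' b' :
  tens_mul (a ⊗ b) (a' ⊗ b') = (a * a') ⊗ (b * b').
Proof.
rewrite /tens_mul (tlift_tens (tens_mul_bilinear_out _)).
by rewrite (tlift_tens (tens_mul_bilinear_in _ _)).
Qed.

Fact tens_mulDl : left_distributive tens_mul +%R.
Proof.
by move=> x y z; have := tens_mul_bilinear.1 z 1 x y; rewrite /= !scale1r.
Qed.

Fact tens_mulDr : right_distributive tens_mul +%R.
Proof.
by move=> x y z; have := tens_mul_bilinear.2 x 1 y z; rewrite /= !scale1r.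
Qed.

Fact tens_mul0l x : tens_mul 0 x = 0.
Proof. by apply: (addrI (tens_mul 0 x)); rewrite -tens_mulDl !addr0. Qed.

Fact tens_mul0r x : tens_mul x 0 = 0.
Proof. by apply: (addrI (tens_mul x 0)); rewrite -tens_mulDr !addr0. Qed.

Fact tens_mulA : associative tens_mul.
Proof.
move=> x y z.
elim/tens_ind: x => [|x x' hx hx'|a b]; first by rewrite !tens_mul0l.
  by rewrite !tens_mulDl hx hx'.
elim/tens_ind: y => [|y y' hy hy'|a' b'].
- by rewrite !(tens_mul0l, tens_mul0r).
- by rewrite !(tens_mulDl, tens_mulDr) hy hy'.
elim/tens_ind: z => [|z z' hz hz'|a'' b'']; first by rewrite !tens_mul0r.
  by rewrite !tens_mulDr hz hz'.
by rewrite !tens_mulE !mulrA.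
Qed.

Fact tens_mul1l : left_id ((1 : A) ⊗ (1 : B)) tens_mul.
Proof.
elim/tens_ind => [|x x' hx hx'|a b]; first by rewrite tens_mul0r.
  by rewrite tens_mulDr hx hx'.
by rewrite tens_mulE !mul1r.
Qed.

Fact tens_mul1r : right_id ((1 : A) ⊗ (1 : B)) tens_mul.
Proof.
elim/tens_ind => [|x x' hx hx'|a b]; first by rewrite tens_mul0l.
  by rewrite tens_mulDl hx hx'.
by rewrite tens_mulE !mulr1.
Qed.

Fact tens_scaleAl c x y : c *: tens_mul x y = tens_mul (c *: x) y.
Proof.
by have := tens_mul_bilinear.1 y c x 0; rewrite /= !addr0 tens_mul0l addr0.
Qed.

Fact tens_scaleAr c x y : c *: tens_mul x y = tens_mul x (c *: y).
Proof.
by have := tens_mul_bilinear.2 x c y 0; rewrite /= !addr0 tens_mul0r addr0.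
Qed.

HB.instance Definition _ := Lmodule_isPzAlgebra.Build k (A ⊗ B)%type
  tens_mulA tens_mul1l tens_mul1r tens_mulDl tens_mulDr
  tens_scaleAl tens_scaleAr.

(* The usual tensor product of algebras; as a space it is A ⊗ B.              *)
Definition tensor_alg : pzAlgType k := (A ⊗ B)%type.

End TensorAlgebra.

Section TensorMaps.
Variable k : fieldType.

Definition tmap (U U' V V' : lmodType k) (f : U -> U') (g : V -> V')
  (x : U ⊗ V) : U' ⊗ V' := \tsum_(u, v <- x) f u ⊗ g v.

(* Iterated tensor products are associated to the right, U ⊗ (V ⊗ W).         *)
Definition tassoc (U V W : lmodType k) (x : (U ⊗ V) ⊗ W) : U ⊗ V ⊗ W :=
  \tsum_(t, w <- x) \tsum_(u, v <- t) u ⊗ v ⊗ w.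

End TensorMaps.

Section QuasiHopf.
Variables (k : fieldType) (H : pzAlgType k).

Local Notation H2 := (tensor_alg H H).
Local Notation H3 := (tensor_alg H H2).
Local Notation H4 := (tensor_alg H H3).

Definition one_tens (x : H3) : H4 := (1 : H) ⊗ x.
Definition tens_one (x : H3) : H4 :=
  \tsum_(a, b, c <- x) a ⊗ b ⊗ c ⊗ (1 : H).

Section CoproductMaps.
Variables (Delta : H -> H2) (eps : H -> k).

Definition id_Delta : H2 -> H3 := tmap id Delta.
Definition Delta_id (x : H2) : H3 := tassoc (tmap Delta id x).
Definition id_id_Delta : H3 -> H4 := tmap id id_Delta.
Definition id_Delta_id : H3 -> H4 := tmap id Delta_id.
Definition Delta_id_id (x : H3) : H4 := tassoc (tmap Delta id x).

(* The identifications k ⊗ H = H = H ⊗ k are built in.                        *)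
Definition eps_id (x : H2) : H := \tsum_(a, b <- x) eps a *: b.
Definition id_eps (x : H2) : H := \tsum_(a, b <- x) eps b *: a.
Definition eps_id_id (x : H3) : H2 := \tsum_(a, t <- x) eps a *: t.
Definition id_eps_id : H3 -> H2 := tmap id eps_id.
Definition id_id_eps : H3 -> H2 := tmap id id_eps.

End CoproductMaps.

Record quasi_bialgebra := QuasiBialgebra {
  Delta : H -> H2;
  eps : H -> k;
  Phi : H3;
  iPhi : H3;
  Delta_algebra_map : algebra_map Delta;
  eps_linear : scalar eps;
  eps_monoid_morphism : monoid_morphism eps;
  Phi_iPhi : Phi * iPhi = 1;
  iPhi_Phi : iPhi * Phi = 1;
  quasi_coassociativity : forall h,
    id_Delta Delta (Delta h) = Phi * Delta_id Delta (Delta h) * iPhi;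
  counit_right : forall h, id_eps eps (Delta h) = h;
  counit_left : forall h, eps_id eps (Delta h) = h;
  pentagon :
    one_tens Phi * id_Delta_id Delta Phi * tens_one Phi
    = id_id_Delta Delta Phi * Delta_id_id Delta Phi;
  eps_id_id_Phi : eps_id_id eps Phi = 1;
  id_eps_id_Phi : id_eps_id eps Phi = 1;
  id_id_eps_Phi : id_id_eps eps Phi = 1
}.

Record quasi_hopf := QuasiHopf {
  quasi_hopf_bialgebra :> quasi_bialgebra;
  antipode : H -> H;
  alpha : H;
  beta : H;
  antipode_anti_automorphism : anti_automorphism antipode;
  antipode_alpha : forall h,
    \tsum_(h1, h2 <- Delta quasi_hopf_bialgebra h)
      (antipode h1 * alpha * h2) = eps quasi_hopf_bialgebra h *: alpha;
  antipode_beta : forall h,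
    \tsum_(h1, h2 <- Delta quasi_hopf_bialgebra h)
      (h1 * beta * antipode h2) = eps quasi_hopf_bialgebra h *: beta;
  antipode_Phi :
    \tsum_(X1, X2, X3 <- Phi quasi_hopf_bialgebra)
      (X1 * beta * antipode X2 * alpha * X3) = 1;
  antipode_iPhi :
    \tsum_(x1, x2, x3 <- iPhi quasi_hopf_bialgebra)
      (antipode x1 * alpha * x2 * beta * antipode x3) = 1;
  eps_alpha : eps quasi_hopf_bialgebra alpha = 1;
  eps_beta : eps quasi_hopf_bialgebra beta = 1;
  eps_antipode : forall h,
    eps quasi_hopf_bialgebra (antipode h) = eps quasi_hopf_bialgebra h
}.

End QuasiHopf.

(* The smash product A # H has the space A ⊗ H.  Its operations are defined   *)
(* from those of the left H-module algebra A, namely the multiplication mul,  *)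
(* the unit one and the action act.                                           *)
Section SmashProduct.
Variables (k : fieldType) (H : pzAlgType k) (Q : quasi_bialgebra H).
Variables (A : lmodType k) (mul : A -> A -> A) (one : A) (act : H -> A -> A).

Definition smash_one : A ⊗ H := one ⊗ (1 : H).

Definition smash_mul (s t : A ⊗ H) : A ⊗ H :=
  \tsum_(a, h <- s) \tsum_(a', h' <- t)
  \tsum_(x1, x2, x3 <- iPhi Q) \tsum_(h1, h2 <- Delta Q h)
    mul (act x1 a) (act (x2 * h1) a') ⊗ (x3 * h2 * h').

End SmashProduct.

Section ModuleAlgebraBv.
Variables (k : fieldType) (H : pzAlgType k) (Q : quasi_hopf H).
Variables (B : pzAlgType k) (v : H -> B).
Local Notation S := (antipode Q).

Definition Bv_mul (b b' : B) : B :=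
  \tsum_(X1, X2, X3 <- Phi Q) \tsum_(x1, x2, x3 <- iPhi Q)
  \tsum_(X31, X32 <- Delta Q X3)
    (v X1 * b * v (S (x1 * X2) * alpha Q * x2 * X31) * b'
      * v (S (x3 * X32))).

Definition Bv_one : B := v (beta Q).

Definition Bv_act (h : H) (b : B) : B :=
  \tsum_(h1, h2 <- Delta Q h) (v h1 * b * v (S h2)).

Definition Bv_smash_mul : B ⊗ H -> B ⊗ H -> B ⊗ H :=
  smash_mul Q Bv_mul Bv_act.

Definition Bv_smash_one : B ⊗ H := smash_one H Bv_one.

Definition psi_simple (b : B) (h : H) : tensor_alg B H :=
  \tsum_(X1, X2, X3 <- Phi Q) \tsum_(x1, x2, x3 <- iPhi Q)
  \tsum_(x11, x12 <- Delta Q x1) \tsum_(h1, h2 <- Delta Q h)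
    (v (X1 * x11) * b * v (S (X2 * x12) * alpha Q * X3 * x2 * h1)) ⊗ (x3 * h2).

Definition psi (t : B ⊗ H) : tensor_alg B H :=
  \tsum_(b, h <- t) psi_simple b h.

Definition xi_simple (b : B) (h : H) : B ⊗ H :=
  \tsum_(Z1, Z2, Z3 <- Phi Q) \tsum_(z1, z2, z3 <- iPhi Q)
  \tsum_(h1, h2 <- Delta Q h)
    (v z1 * b * v (Z1 * beta Q * S (z2 * h1 * Z2))) ⊗ (z3 * h2 * Z3).

Definition xi (t : tensor_alg B H) : B ⊗ H :=
  \tsum_(b, h <- t) xi_simple b h.

End ModuleAlgebraBv.

(* Main.v *)
(* Write [kappa b = v(X1) b v(S(X2) alpha X3)].  A coproduct inserted next to
   [S(_) alpha _] or [_ beta S(_)] is absorbed, so quasi-coassociativity gives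
   [kappa(h_1 . b) v(h_2) = v(h) kappa(b)], and the pentagon gives
   [b * c = kappa(x1 . b) v(x2) c v(S x3)] for the product of B^v and
   [kappa((x1 . b) * (x2 . c)) v(x3) = kappa(b) kappa(c)].  With
   [j b = kappa(x1 . b) v(x2) ⊗ x3] and [d h = v(h_1) ⊗ h_2] one has
   [psi (b # h) = j b d h], and these rules together with the pentagon yield
   [d h j b = j(h_1 . b) d h_2] and [j((x1 . b) * (x2 . c)) d x3 = j b j c], that
   is, multiplicativity of psi.  Bijectivity is two more pentagon computations,
   and the algebra axioms of B^v # H are transported along psi. *)
Require Import Defs.
From mathcomp Require Import all_boot all_order all_algebra.
Import GRing.Theory.
Set Implicit Arguments.
Unset Strict Implicit.
Unset Printing Implicit Defensive.
Local Open Scope ring_scope.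
Local Open Scope tensor_scope.

(** * Multilinear maps and their closure properties *)

Definition lin (k : fieldType) (U V : lmodType k) (f : U -> V) : Prop :=
  linear f.

(** Phrased through [lin] in each argument, so that splitting leaves goals which [lin_tac]
    recognises by their head symbol; [bilin_for] returns to the library form. *)
Definition bilin (k : fieldType) (U V W : lmodType k) (F : U -> V -> W) : Prop :=
  (forall u, lin (F u)) /\ (forall v, lin (fun u => F u v)).

Definition trilin (k : fieldType) (U V W X : lmodType k)
    (F : U -> V -> W -> X) : Prop :=
  (forall u, bilin (F u)) /\ (forall v w, lin (fun u => F u v w)).

Definition quadlin (k : fieldType) (U V W X Y : lmodType k)
    (F : U -> V -> W -> X -> Y) : Prop :=
  (forall u, trilin (F u)) /\ (forall v w x, lin (fun u => F u v w x)).

Section Lin.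
Variable k : fieldType.
Implicit Types U V W X Y Z : lmodType k.
Implicit Types A B : pzAlgType k.

Lemma bilin_for U V W (F : U -> V -> W) :
  bilin F -> bilinear_for *:%R *:%R F.
Proof. by case=> Fr Fl; split=> [v|u] a x y; [apply: Fl|apply: Fr]. Qed.

Lemma lin_id U : lin (fun x : U => x).
Proof. by []. Qed.

Lemma lin_comp U V W (g : V -> W) (f : U -> V) :
  lin g -> lin f -> lin (fun x => g (f x)).
Proof. by move=> gL fL a x y; rewrite fL gL. Qed.

Lemma lin_mull U A (f : U -> A) c : lin f -> lin (fun x => f x * c).
Proof. by move=> fL a x y; rewrite fL mulrDl pzscalerAl. Qed.

Lemma lin_mulr U A (f : U -> A) c : lin f -> lin (fun x => c * f x).
Proof. by move=> fL a x y; rewrite fL mulrDr pzscalerAr. Qed.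

Lemma lin_scale U V (f : U -> V) c : lin f -> lin (fun x => c *: f x).
Proof. by move=> fL a x y; rewrite fL scalerDr !scalerA mulrC. Qed.

Lemma lin_scaler U V (g : U -> k) c : scalar g -> lin (fun x => g x *: c : V).
Proof. by move=> gL a x y; rewrite gL scalerDl scalerA. Qed.

Lemma scalar_comp U V (g : V -> k) (f : U -> V) :
  scalar g -> lin f -> scalar (fun x => g (f x)).
Proof. by move=> gL fL a x y; rewrite fL gL. Qed.

Lemma linZ U V (f : U -> V) a x : lin f -> f (a *: x) = a *: f x.
Proof.
move=> fL; have f0 : f 0 = 0.
  by apply: (addIr (f 0)); rewrite -{1}[f 0]scale1r -fL scaler0 add0r add0r.
by have := fL a x 0; rewrite f0 !addr0.
Qed.

(** [tlift] is a finite sum over a representative, so additivity of [f] suffices and nothing is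
    asked of [F]. *)
Lemma lin_sum U V V' W (f : V' -> W) (F : U -> V -> V') t : lin f ->
  f (tlift t F) = tlift t (fun a b => f (F a b)).
Proof.
move=> fL; have fD x y : f (x + y) = f x + f y.
  by rewrite -[x]scale1r fL !scale1r.
have f0 : f 0 = 0 by apply: (addIr (f 0)); rewrite -fD !add0r.
exact: (big_morph f fD f0).
Qed.

Lemma lin_fun2l U V W X (F : V -> W -> X) (f : U -> V) w :
  bilin F -> lin f -> lin (fun x => F (f x) w).
Proof. by case=> _ FL fL; apply: lin_comp (FL w) fL. Qed.

Lemma lin_fun2r U V W X (F : V -> W -> X) (f : U -> W) v :
  bilin F -> lin f -> lin (fun x => F v (f x)).
Proof. by case=> FL _ fL; apply: lin_comp (FL v) fL. Qed.

Lemma lin_fun31 U V W X Y (F : V -> W -> X -> Y) (f : U -> V) w x :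
  trilin F -> lin f -> lin (fun u => F (f u) w x).
Proof. by case=> _ FL fL; apply: lin_comp (FL w x) fL. Qed.

Lemma lin_fun32 U V W X Y (F : V -> W -> X -> Y) (f : U -> W) v x :
  trilin F -> lin f -> lin (fun u => F v (f u) x).
Proof. by case=> FL _; apply: lin_fun2l. Qed.

Lemma lin_fun33 U V W X Y (F : V -> W -> X -> Y) (f : U -> X) v w :
  trilin F -> lin f -> lin (fun u => F v w (f u)).
Proof. by case=> FL _; apply: lin_fun2r. Qed.

Lemma lin_fun41 U V W X Y Z (F : V -> W -> X -> Y -> Z) (f : U -> V) w x y :
  quadlin F -> lin f -> lin (fun u => F (f u) w x y).
Proof. by case=> _ FL fL; apply: lin_comp (FL w x y) fL. Qed.

Lemma lin_fun42 U V W X Y Z (F : V -> W -> X -> Y -> Z) (f : U -> W) v x y :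
  quadlin F -> lin f -> lin (fun u => F v (f u) x y).
Proof. by case=> FL _; apply: lin_fun31. Qed.

Lemma lin_fun43 U V W X Y Z (F : V -> W -> X -> Y -> Z) (f : U -> X) v w y :
  quadlin F -> lin f -> lin (fun u => F v w (f u) y).
Proof. by case=> FL _; apply: lin_fun32. Qed.

Lemma lin_fun44 U V W X Y Z (F : V -> W -> X -> Y -> Z) (f : U -> Y) v w x :
  quadlin F -> lin f -> lin (fun u => F v w x (f u)).
Proof. by case=> FL _; apply: lin_fun33. Qed.

Lemma lin_tensl U V W (f : U -> V) (w : W) : lin f -> lin (fun x => f x ⊗ w).
Proof. by move=> fL a x y; rewrite fL tensDl tensZl. Qed.

Lemma lin_tensr U V W (f : U -> V) (w : W) : lin f -> lin (fun x => w ⊗ f x).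
Proof. by move=> fL a x y; rewrite fL tensDr tensZr. Qed.

(** Here the variable sits in the summand and the representative of [t] is fixed, so [F x] may be
    any function of the components. When the variable sits in the tensor, as in [lin_tlift_arg],
    bilinearity of the summand is what makes the choice of representative harmless. *)
Lemma lin_tlift U V V' W (t : V ⊗ V') (F : U -> V -> V' -> W) :
  (forall a b, lin (fun x => F x a b)) -> lin (fun x => tlift t (F x)).
Proof.
move=> FL c x y; rewrite -tlift_fun_linear.
by apply: eq_tlift => a b; apply: FL.
Qed.

Lemma lin_tlift_arg U V V' W (f : U -> V ⊗ V') (F : V -> V' -> W) :
  bilin F -> lin f -> lin (fun x => tlift (f x) F).
Proof. by move=> /bilin_for FL fL c x y; rewrite fL (tlift_linear FL). Qed.

Lemma tlift_pure U V W (F : U -> V -> W) u v :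
  bilin F -> tlift (u ⊗ v) F = F u v.
Proof. by move=> /bilin_for FL; apply: tlift_tens. Qed.

Lemma tens_lin_ext U V W (f g : U ⊗ V -> W) :
  lin f -> lin g -> (forall u v, f (u ⊗ v) = g (u ⊗ v)) -> forall x, f x = g x.
Proof. exact: tens_eq_linear. Qed.

Lemma mul_pure A B (a a' : A) (b b' : B) :
  (a ⊗ b : tensor_alg A B) * (a' ⊗ b') = (a * a') ⊗ (b * b').
Proof. exact: tens_mulE. Qed.

End Lin.

(* Redefined below, once the basic linear maps are available. *)
Ltac lin_map := fail.

(** Recursion on the body of the function: at each product, tensor or sum the variable may occur on
    one side only, and named maps are left to [lin_map]. *)
Ltac lin_tac :=
  cbv beta;
  match goal with
  | |- bilin _ => split; intros; lin_tac
  | |- trilin _ => split; intros; lin_tac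
  | |- quadlin _ => split; intros; lin_tac
  | |- forall _, _ => intros ?; lin_tac
  | |- scalar _ => lin_map
  | |- lin (fun x => x) => exact (@lin_id _ _)
  | |- @lin ?k ?U ?V ?F =>
      (* Unifying the two module structures of an iterated tensor product takes
         seconds, whereas the kernel converts them at once. *)
      lazymatch F with
      | fun x =>
          @GRing.mul (@PzAlgebra_sort__canonical__GRing_PzSemiRing _ ?A) _ _ =>
        change_no_check (@lin k U A F)
      end;
      match goal with
      | |- lin (fun x => @GRing.mul _ (@?f x) ?c) =>
          refine (@lin_mull _ _ _ f c _); lin_tac
      | |- lin (fun x => @GRing.mul _ ?c (@?f x)) =>
          refine (@lin_mulr _ _ _ f c _); lin_tac
      end
  | |- lin (fun x => tens (@?f x) ?c) =>
      refine (@lin_tensl _ _ _ _ f c _); lin_tac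
  | |- lin (fun x => tens ?c (@?f x)) =>
      refine (@lin_tensr _ _ _ _ f c _); lin_tac
  | |- lin (fun x => tlift ?t (@?f x)) =>
      refine (@lin_tlift _ _ _ _ _ t f _); lin_tac
  | |- lin (fun x => tlift (@?f x) ?c) =>
      refine (@lin_tlift_arg _ _ _ _ _ f c _ _); lin_tac
  | |- lin (fun x => @GRing.scale _ _ ?c (@?f x)) =>
      refine (@lin_scale _ _ _ f c _); lin_tac
  | |- lin (fun x => @GRing.scale _ _ (@?f x) ?c) =>
      refine (@lin_scaler _ _ _ f c _); lin_tac
  | |- lin _ => lin_map
  end.

(** * Maps between tensor products and equality on pure tensors *)

Section TensorMaps.
Variable k : fieldType.
Implicit Types U V W X Y Z : lmodType k.

Lemma lin_tmap U U' V V' (f : U -> U') (g : V -> V') :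
  lin f -> lin g -> lin (tmap f g).
Proof.
move=> fL gL; refine (lin_tlift_arg _ (@lin_id _ _)).
by split=> ?; [apply: lin_tensr|apply: lin_tensl].
Qed.

Lemma tmap_pure U U' V V' (f : U -> U') (g : V -> V') u v :
  lin f -> lin g -> tmap f g (u ⊗ v) = f u ⊗ g v.
Proof.
move=> fL gL; apply: tlift_pure.
by split=> ?; [apply: lin_tensr|apply: lin_tensl].
Qed.

Lemma lin_tassoc U V W : lin (@tassoc k U V W).
Proof. rewrite /tassoc; lin_tac. Qed.

Lemma tassoc_pure U V W (u : U) (v : V) (w : W) :
  tassoc ((u ⊗ v) ⊗ w) = u ⊗ v ⊗ w.
Proof. by rewrite /tassoc tlift_pure ?tlift_pure //; lin_tac. Qed.

End TensorMaps.

Notation "\tsum_ ( a , b , c , d <- t ) E" :=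
  (tlift t (fun a u => tlift u (fun b w => tlift w (fun c d => E))))
  (at level 36, a name, b name, c name, d name, t at level 50, E at level 41,
   right associativity) : ring_scope.

(* An equation linear in the tensor [t] need only be checked on pure tensors;
   distinct copies of [Phi] or [iPhi] must be generalized separately before. *)
Ltac ext_at_as t tac :=
  lazymatch goal with
  | |- ?L = ?R =>
    let f := lazymatch (eval pattern t in L) with ?f _ => f end in
    let g := lazymatch (eval pattern t in R) with ?g _ => g end in
    refine (@tens_lin_ext _ _ _ _ f g _ _ _ t); [lin_tac|lin_tac|tac tt]
  end.

Ltac ext_at t := ext_at_as t ltac:(fun _ => intros ? ?; cbv beta).

(** * Linearity and multiplicativity of the structure maps *)

Section AlgebraMaps.
Variables (k : fieldType) (A B : pzAlgType k) (f : A -> B).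
Hypothesis fA : algebra_map f.

Lemma algebra_map_lin : lin f. Proof. by case: fA. Qed.

Lemma algebra_mapM : {morph f : x y / x * y}.
Proof. by case: fA => _ [_]. Qed.

Lemma algebra_map1 : f 1 = 1.
Proof. by case: fA => _ []. Qed.

End AlgebraMaps.

Section QuasiBialgebra.
Variables (k : fieldType) (H : pzAlgType k) (Q : quasi_bialgebra H).

Lemma lin_Delta : lin (Delta Q).
Proof. exact: algebra_map_lin (Delta_algebra_map Q). Qed.

Lemma DeltaM : {morph Delta Q : x y / x * y}.
Proof. exact: algebra_mapM (Delta_algebra_map Q). Qed.

Lemma Delta1 : Delta Q 1 = 1.
Proof. exact: algebra_map1 (Delta_algebra_map Q). Qed.

Lemma epsM : {morph eps Q : x y / x * y}.
Proof. by case: (eps_monoid_morphism Q). Qed.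

Lemma eps1 : eps Q 1 = 1.
Proof. by case: (eps_monoid_morphism Q). Qed.

End QuasiBialgebra.

Section Antipode.
Variables (k : fieldType) (H : pzAlgType k) (Q : quasi_hopf H).

Lemma lin_antipode : lin (antipode Q).
Proof. by case: (antipode_anti_automorphism Q). Qed.

Lemma antipodeM : {morph antipode Q : x y / x * y >-> y * x}.
Proof. by case: (antipode_anti_automorphism Q). Qed.

Lemma antipode1 : antipode Q 1 = 1.
Proof. by case: (antipode_anti_automorphism Q). Qed.

End Antipode.

Ltac lin_map ::=
  match goal with
  | |- lin (fun x => x) => exact (@lin_id _ _)
  | fA : algebra_map ?v |- lin (fun x => ?v (@?f x)) =>
      refine (@lin_comp _ _ _ _ v f (algebra_map_lin fA) _); lin_tac
  | vL : lin ?v |- lin (fun x => ?v (@?f x)) =>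
      refine (@lin_comp _ _ _ _ v f vL _); lin_tac
  | |- lin (fun x => Delta ?q (@?f x)) =>
      refine (@lin_comp _ _ _ _ (Delta q) f (lin_Delta _) _); lin_tac
  | |- lin (Delta _) => exact (@lin_Delta _ _ _)
  | |- lin (fun x => antipode ?q (@?f x)) =>
      refine (@lin_comp _ _ _ _ (antipode q) f (lin_antipode _) _); lin_tac
  | |- lin (fun x => tmap ?g ?h (@?f x)) =>
      refine (@lin_comp _ _ _ _ (tmap g h) f (lin_tmap _ _) _); lin_tac
  | |- lin (tmap _ _) => refine (lin_tmap _ _); lin_tac
  | |- lin (fun x => tassoc (@?f x)) =>
      refine (@lin_comp _ _ _ _ (@tassoc _ _ _ _) f (@lin_tassoc _ _ _ _) _);
      lin_tac
  | |- scalar (fun x => eps ?q (@?f x)) =>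
      refine (@scalar_comp _ _ _ (eps q) f (eps_linear _) _); lin_tac
  | |- lin id => exact (@lin_id _ _)
  | FL : bilin ?F |- lin (fun x => ?F (@?f x) _) =>
      refine (@lin_fun2l _ _ _ _ _ F f _ FL _); lin_tac
  | FL : bilin ?F |- lin (fun x => ?F _ (@?f x)) =>
      refine (@lin_fun2r _ _ _ _ _ F f _ FL _); lin_tac
  | FL : trilin ?F |- lin (fun x => ?F (@?f x) _ _) =>
      refine (@lin_fun31 _ _ _ _ _ _ F f _ _ FL _); lin_tac
  | FL : trilin ?F |- lin (fun x => ?F _ (@?f x) _) =>
      refine (@lin_fun32 _ _ _ _ _ _ F f _ _ FL _); lin_tac
  | FL : trilin ?F |- lin (fun x => ?F _ _ (@?f x)) =>
      refine (@lin_fun33 _ _ _ _ _ _ F f _ _ FL _); lin_tac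
  | FL : quadlin ?F |- lin (fun x => ?F (@?f x) _ _ _) =>
      refine (@lin_fun41 _ _ _ _ _ _ _ F f _ _ _ FL _); lin_tac
  | FL : quadlin ?F |- lin (fun x => ?F _ (@?f x) _ _) =>
      refine (@lin_fun42 _ _ _ _ _ _ _ F f _ _ _ FL _); lin_tac
  | FL : quadlin ?F |- lin (fun x => ?F _ _ (@?f x) _) =>
      refine (@lin_fun43 _ _ _ _ _ _ _ F f _ _ _ FL _); lin_tac
  | FL : quadlin ?F |- lin (fun x => ?F _ _ _ (@?f x)) =>
      refine (@lin_fun44 _ _ _ _ _ _ _ F f _ _ _ FL _); lin_tac
  | |- _ => assumption
  end.

(** * Automatic evaluation of Sweedler sums on pure tensors *)

Ltac eval_step :=
  cbv beta;
  match goal with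
  | |- context [tlift (tens ?u ?v) ?F] =>
      rewrite (@tlift_pure _ _ _ _ F u v); [|lin_tac]
  | |- context [tmap ?f ?g (tens ?u ?v)] =>
      rewrite (@tmap_pure _ _ _ _ _ f g u v); [|lin_tac|lin_tac]
  | |- context [tassoc (tens (tens ?u ?v) ?w)] =>
      rewrite (@tassoc_pure _ _ _ _ u v w)
  | |- context [@GRing.mul _ (tens ?u ?v) (tens ?u' ?v')] =>
      rewrite (@mul_pure _ _ _ u u' v v')
  | |- context [Delta ?q (?x * ?y)] => rewrite (@DeltaM _ _ q x y)
  end.

Ltac eval_pure := repeat eval_step; cbv beta.

(** [eval_step] has priority and splits [Delta] of a product, so that both sides are reduced to
    coproducts of the same elements before these are opened. *)
Ltac sweedler :=
  repeat first
    [ eval_step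
    | match goal with
      | |- context [Delta ?q ?x] => ext_at (Delta q x)
      | |- context [tlift ?x _] => ext_at x
      end ];
  cbv beta.

Tactic Notation "ext" constr(t) "as" ident(a) ident(b) :=
  ext_at_as t ltac:(fun _ => intros a b; cbv beta).
Tactic Notation "ext" constr(t) "as" ident(a) ident(b) ident(c) :=
  let w := fresh "w" in
  ext_at_as t ltac:(fun _ => intros a w; cbv beta);
  ext_at_as w ltac:(fun _ => intros b c; cbv beta); clear w.

(** * The maps into [H4] in the pentagon, and the counit conditions for [iPhi] *)

Section Coherence.
Variables (k : fieldType) (H : pzAlgType k) (Q : quasi_bialgebra H).
Local Notation H2 := (tensor_alg H H).
Local Notation H3 := (tensor_alg H H2).
Local Notation H4 := (tensor_alg H H3).

Lemma one_pure (A B : pzAlgType k) : (1 : tensor_alg A B) = (1 : A) ⊗ (1 : B).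
Proof. by []. Qed.

Lemma tens_oneM : {morph @tens_one k H : x y / x * y}.
Proof.
move=> x y; rewrite /tens_one; ext x as a b c; ext y as a' b' c'; sweedler.
by rewrite mulr1.
Qed.

Lemma tens_one1 : tens_one 1 = 1 :> H4.
Proof. by rewrite /tens_one !one_pure; eval_pure. Qed.

Lemma one_tensM : {morph @one_tens k H : x y / x * y}.
Proof. by move=> x y; rewrite /one_tens mul_pure mulr1. Qed.

Lemma id_id_DeltaM : {morph id_id_Delta (Delta Q) : x y / x * y}.
Proof.
move=> x y; rewrite /id_id_Delta /id_Delta.
by ext x as a b c; ext y as a' b' c'; sweedler.
Qed.

Lemma id_id_Delta1 : id_id_Delta (Delta Q) 1 = 1.
Proof.
by rewrite /id_id_Delta /id_Delta !one_pure; eval_pure; rewrite Delta1.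
Qed.

Lemma id_Delta_idM : {morph id_Delta_id (Delta Q) : x y / x * y}.
Proof.
move=> x y; rewrite /id_Delta_id /Delta_id.
by ext x as a b c; ext y as a' b' c'; sweedler.
Qed.

Lemma id_Delta_id1 : id_Delta_id (Delta Q) 1 = 1.
Proof.
rewrite /id_Delta_id /Delta_id !one_pure; eval_pure.
by rewrite Delta1 one_pure tassoc_pure.
Qed.

Lemma Delta_id_idM : {morph Delta_id_id (Delta Q) : x y / x * y}.
Proof.
move=> x y; rewrite /Delta_id_id.
by ext x as a b c; ext y as a' b' c'; sweedler.
Qed.

Lemma Delta_id_id1 : Delta_id_id (Delta Q) 1 = 1.
Proof.
rewrite /Delta_id_id !one_pure; eval_pure.
by rewrite Delta1 one_pure tassoc_pure.
Qed.

Lemma eps_id_idM : {morph eps_id_id (eps Q) : x y / x * y}.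
Proof.
move=> x y; rewrite /eps_id_id; ext x as a b c; ext y as a' b' c'; eval_pure.
by rewrite epsM -pzscalerAl -pzscalerAr scalerA mul_pure.
Qed.

Lemma id_eps_idM : {morph id_eps_id (eps Q) : x y / x * y}.
Proof.
move=> x y; rewrite /id_eps_id /eps_id.
ext x as a b c; ext y as a' b' c'; eval_pure.
by rewrite epsM -pzscalerAl -pzscalerAr scalerA.
Qed.

Lemma id_id_epsM : {morph id_id_eps (eps Q) : x y / x * y}.
Proof.
move=> x y; rewrite /id_id_eps /id_eps.
ext x as a b c; ext y as a' b' c'; eval_pure.
by rewrite epsM -pzscalerAl -pzscalerAr scalerA.
Qed.

(** The map is multiplicative and sends [Phi] to 1, so it is applied to [Phi * iPhi = 1]. The other
    two counit conditions follow in the same way. *)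
Lemma eps_id_id_iPhi : eps_id_id (eps Q) (iPhi Q) = 1.
Proof.
have := eps_id_idM (Phi Q) (iPhi Q); rewrite Phi_iPhi eps_id_id_Phi mul1r => <-.
by rewrite /eps_id_id one_pure; eval_pure; rewrite eps1 scale1r.
Qed.

Lemma id_eps_id_iPhi : id_eps_id (eps Q) (iPhi Q) = 1.
Proof.
have := id_eps_idM (Phi Q) (iPhi Q); rewrite Phi_iPhi id_eps_id_Phi mul1r => <-.
by rewrite /id_eps_id /eps_id !one_pure; eval_pure; rewrite eps1 scale1r.
Qed.

Lemma id_id_eps_iPhi : id_id_eps (eps Q) (iPhi Q) = 1.
Proof.
have := id_id_epsM (Phi Q) (iPhi Q); rewrite Phi_iPhi id_id_eps_Phi mul1r => <-.
by rewrite /id_id_eps /id_eps !one_pure; eval_pure; rewrite eps1 scale1r.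
Qed.

(** * Invertibility of the five factors of the pentagon *)

Lemma Delta_id_id_Phi_inv :
  Delta_id_id (Delta Q) (Phi Q) * Delta_id_id (Delta Q) (iPhi Q) = 1.
Proof. by rewrite -Delta_id_idM Phi_iPhi Delta_id_id1. Qed.

Lemma id_Delta_id_iPhi_inv :
  id_Delta_id (Delta Q) (iPhi Q) * id_Delta_id (Delta Q) (Phi Q) = 1.
Proof. by rewrite -id_Delta_idM iPhi_Phi id_Delta_id1. Qed.

Lemma id_id_Delta_Phi_inv :
  id_id_Delta (Delta Q) (Phi Q) * id_id_Delta (Delta Q) (iPhi Q) = 1.
Proof. by rewrite -id_id_DeltaM Phi_iPhi id_id_Delta1. Qed.

Lemma id_id_Delta_iPhi_inv :
  id_id_Delta (Delta Q) (iPhi Q) * id_id_Delta (Delta Q) (Phi Q) = 1.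
Proof. by rewrite -id_id_DeltaM iPhi_Phi id_id_Delta1. Qed.

Lemma one_tens_Phi_inv : one_tens (Phi Q) * one_tens (iPhi Q) = 1.
Proof. by rewrite -one_tensM Phi_iPhi. Qed.

Lemma Delta_id_id_iPhi_inv :
  Delta_id_id (Delta Q) (iPhi Q) * Delta_id_id (Delta Q) (Phi Q) = 1.
Proof. by rewrite -Delta_id_idM iPhi_Phi Delta_id_id1. Qed.

Lemma id_Delta_id_Phi_inv :
  id_Delta_id (Delta Q) (Phi Q) * id_Delta_id (Delta Q) (iPhi Q) = 1.
Proof. by rewrite -id_Delta_idM Phi_iPhi id_Delta_id1. Qed.

Lemma one_tens_iPhi_inv : one_tens (iPhi Q) * one_tens (Phi Q) = 1.
Proof. by rewrite -one_tensM iPhi_Phi. Qed.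

Lemma tens_one_Phi_inv : tens_one (Phi Q) * tens_one (iPhi Q) = 1.
Proof. by rewrite -tens_oneM Phi_iPhi tens_one1. Qed.

End Coherence.

(** * The pentagon solved for various factors, in an arbitrary ring *)

Section PentagonAlgebra.
Variables (R : pzRingType) (o m t r l o' m' t' r' l' : R).
Hypotheses (pent : o * m * t = r * l) (o'o : o' * o = 1) (m'm : m' * m = 1)
  (tt' : t * t' = 1) (mm' : m * m' = 1) (oo' : o * o' = 1)
  (ll' : l * l' = 1) (l'l : l' * l = 1) (rr' : r * r' = 1) (r'r : r' * r = 1).

(** The letters [o], [m], [t], [r], [l] stand for the images of [Phi] under [one_tens],
    [id_Delta_id], [tens_one], [id_id_Delta], [Delta_id_id], and primes for the images of [iPhi]. *)
Lemma pent1 : t * l' = m' * (o' * r).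
Proof.
have -> : t = m' * (o' * (r * l)).
  by rewrite -pent -[o * m * t]mulrA (mulrA o') o'o mul1r mulrA m'm mul1r.
by rewrite -!mulrA ll' mulr1.
Qed.

Lemma pent2 : t' * m' * o' = l' * r'.
Proof.
have: l' * r' * (o * m * t) = 1.
  by rewrite pent -[l' * r' * _]mulrA (mulrA r') r'r mul1r l'l.
move=> /(congr1 (fun x => x * (t' * m' * o'))); rewrite mul1r => <-.
by rewrite -!mulrA (mulrA t) tt' mul1r (mulrA m) mm' mul1r oo' mulr1.
Qed.

Lemma pent3 : l * (t' * m') = r' * o.
Proof.
have -> : l = r' * (o * m * t) by rewrite pent mulrA r'r mul1r.
by rewrite -!mulrA (mulrA t) tt' mul1r mm' mulr1.
Qed.

Lemma pent4 : t * l' * r' = m' * o'.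
Proof. by rewrite pent1 -!mulrA rr' mulr1. Qed.

End PentagonAlgebra.

(** * The axioms as rewriting rules for Sweedler sums *)

Section SweedlerRules.
Variables (k : fieldType) (H : pzAlgType k) (Q : quasi_hopf H).
Local Notation H2 := (tensor_alg H H).
Local Notation H3 := (tensor_alg H H2).
Local Notation H4 := (tensor_alg H H3).
Local Notation D := (Delta Q).
Local Notation S := (antipode Q).
Local Notation eps := (eps Q).
Local Notation alpha := (alpha Q).
Local Notation beta := (beta Q).
Local Notation Phi := (Phi Q).
Local Notation iPhi := (iPhi Q).
Variable W : lmodType k.

Lemma tsum_counit_right (f : H -> W) h : lin f ->
  \tsum_(h1, h2 <- D h) eps h2 *: f h1 = f h.
Proof.
move=> fL; rewrite -{2}[h](counit_right Q) /id_eps lin_sum //.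
by apply: eq_tlift => a b; rewrite linZ.
Qed.

Lemma tsum_counit_left (f : H -> W) h : lin f ->
  \tsum_(h1, h2 <- D h) eps h1 *: f h2 = f h.
Proof.
move=> fL; rewrite -{2}[h](counit_left Q) /eps_id lin_sum //.
by apply: eq_tlift => a b; rewrite linZ.
Qed.

Lemma tsum_alpha (f : H -> W) h : lin f ->
  \tsum_(h1, h2 <- D h) f (S h1 * alpha * h2) = eps h *: f alpha.
Proof. by move=> fL; rewrite -linZ // -antipode_alpha lin_sum. Qed.

Lemma tsum_beta (f : H -> W) h : lin f ->
  \tsum_(h1, h2 <- D h) f (h1 * beta * S h2) = eps h *: f beta.
Proof. by move=> fL; rewrite -linZ // -antipode_beta lin_sum. Qed.

Lemma tsum_eps_iPhi1 (F : H -> H -> W) : bilin F ->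
  \tsum_(x1, x2, x3 <- iPhi) eps x1 *: F x2 x3 = F 1 1.
Proof.
move=> FL; have := congr1 (fun t : H ⊗ H => \tsum_(a, b <- t) F a b)
  (eps_id_id_iPhi Q).
rewrite one_pure; eval_pure => <-; rewrite /eps_id_id.
ext iPhi as a b c; eval_pure; rewrite -tensZl; eval_pure.
by rewrite (linZ (f := fun z => F z c)); last lin_tac.
Qed.

Lemma tsum_eps_iPhi2 (F : H -> H -> W) : bilin F ->
  \tsum_(x1, x2, x3 <- iPhi) eps x2 *: F x1 x3 = F 1 1.
Proof.
move=> FL; have := congr1 (fun t : H ⊗ H => \tsum_(a, b <- t) F a b)
  (id_eps_id_iPhi Q).
rewrite one_pure; eval_pure => <-; rewrite /id_eps_id /eps_id.
ext iPhi as a b c; eval_pure.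
by rewrite (linZ (f := fun z => F a z)); last lin_tac.
Qed.

Lemma tsum_eps_iPhi3 (F : H -> H -> W) : bilin F ->
  \tsum_(x1, x2, x3 <- iPhi) eps x3 *: F x1 x2 = F 1 1.
Proof.
move=> FL; have := congr1 (fun t : H ⊗ H => \tsum_(a, b <- t) F a b)
  (id_id_eps_iPhi Q).
rewrite one_pure; eval_pure => <-; rewrite /id_id_eps /id_eps.
ext iPhi as a b c; eval_pure.
by rewrite (linZ (f := fun z => F a z)); last lin_tac.
Qed.

Lemma tsum_eps_Phi3 (F : H -> H -> W) : bilin F ->
  \tsum_(X1, X2, X3 <- Phi) eps X3 *: F X1 X2 = F 1 1.
Proof.
move=> FL; have := congr1 (fun t : H ⊗ H => \tsum_(a, b <- t) F a b)
  (id_id_eps_Phi Q).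
rewrite one_pure; eval_pure => <-; rewrite /id_id_eps /id_eps.
ext Phi as a b c; eval_pure.
by rewrite (linZ (f := fun z => F a z)); last lin_tac.
Qed.

Lemma tsum_iPhi_Phi (F : H -> H -> H -> W) : trilin F ->
  \tsum_(x1, x2, x3 <- iPhi) \tsum_(X1, X2, X3 <- Phi)
    F (x1 * X1) (x2 * X2) (x3 * X3) = F 1 1 1.
Proof.
move=> FL; have := congr1 (fun t : H ⊗ H ⊗ H => \tsum_(a, b, c <- t) F a b c)
  (iPhi_Phi Q).
rewrite !one_pure; eval_pure => <-; move: Phi iPhi => s t.
by ext s as X1 X2 X3; ext t as x1 x2 x3; eval_pure.
Qed.

(** Quasi-coassociativity with [iPhi] moved to the other side, [Phi * Delta_id (D h) = id_Delta (D
    h) * Phi], read through the linear functional [G] on [H3] that [F] induces. *)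
Lemma tsum_coassoc_Phi (F : H -> H -> H -> W) h : trilin F ->
  \tsum_(X1, X2, X3 <- Phi) \tsum_(h1, h2 <- D h) \tsum_(h11, h12 <- D h1)
    F (X1 * h11) (X2 * h12) (X3 * h2)
  = \tsum_(h1, h2 <- D h) \tsum_(h21, h22 <- D h2)
    \tsum_(X1, X2, X3 <- Phi) F (h1 * X1) (h21 * X2) (h22 * X3).
Proof.
move=> FL; pose G (x : H3) := \tsum_(a, b, c <- x) F a b c.
transitivity (G (Phi * Delta_id D (D h))).
  rewrite /G /Delta_id; move: Phi (D h) => s t.
  ext s as X1 X2 X3; ext t as h1 h2; sweedler.
  by [].
have -> : Phi * Delta_id D (D h) = id_Delta D (D h) * Phi.
  by rewrite quasi_coassociativity -!mulrA iPhi_Phi mulr1.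
rewrite /G /id_Delta; move: Phi (D h) => s t.
by ext s as X1 X2 X3; ext t as h1 h2; sweedler.
Qed.

Lemma tsum_coassoc_iPhi (F : H -> H -> H -> W) h : trilin F ->
  \tsum_(x1, x2, x3 <- iPhi) \tsum_(h1, h2 <- D h) \tsum_(h21, h22 <- D h2)
    F (x1 * h1) (x2 * h21) (x3 * h22)
  = \tsum_(h1, h2 <- D h) \tsum_(h11, h12 <- D h1)
    \tsum_(x1, x2, x3 <- iPhi) F (h11 * x1) (h12 * x2) (h2 * x3).
Proof.
move=> FL; pose G (x : H3) := \tsum_(a, b, c <- x) F a b c.
transitivity (G (iPhi * id_Delta D (D h))).
  rewrite /G /id_Delta; move: iPhi (D h) => s t.
  by ext s as X1 X2 X3; ext t as h1 h2; sweedler.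
have -> : iPhi * id_Delta D (D h) = Delta_id D (D h) * iPhi.
  by rewrite quasi_coassociativity !mulrA iPhi_Phi mul1r.
rewrite /G /Delta_id; move: iPhi (D h) => s t.
by ext s as X1 X2 X3; ext t as h1 h2; sweedler.
Qed.

(** * The pentagon, read through a multilinear map and the antipode axioms *)

Lemma pentagon_form1 :
  tens_one Phi * Delta_id_id D iPhi
  = id_Delta_id D iPhi * (one_tens iPhi * id_id_Delta D Phi) :> H4.
Proof.
apply: (pent1 (pentagon Q) (one_tens_iPhi_inv Q) (id_Delta_id_iPhi_inv Q)).
exact: Delta_id_id_Phi_inv.
Qed.

Lemma pentagon_form4 :
  tens_one Phi * Delta_id_id D iPhi * id_id_Delta D iPhi
  = id_Delta_id D iPhi * one_tens iPhi :> H4.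
Proof.
apply: (pent4 (pentagon Q) (one_tens_iPhi_inv Q) (id_Delta_id_iPhi_inv Q)).
  exact: Delta_id_id_Phi_inv.
exact: id_id_Delta_Phi_inv.
Qed.

Lemma pentagon_form3 :
  Delta_id_id D Phi * (tens_one iPhi * id_Delta_id D iPhi)
  = id_id_Delta D iPhi * one_tens Phi :> H4.
Proof.
apply: (pent3 (pentagon Q)).
- exact: tens_one_Phi_inv.
- exact: id_Delta_id_Phi_inv.
- exact: id_id_Delta_iPhi_inv.
Qed.

Lemma pentagon_form2 :
  tens_one iPhi * id_Delta_id D iPhi * one_tens iPhi
  = Delta_id_id D iPhi * id_id_Delta D iPhi :> H4.
Proof.
apply: (pent2 (pentagon Q)).
- exact: tens_one_Phi_inv.
- exact: id_Delta_id_Phi_inv.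
- exact: one_tens_Phi_inv.
- exact: Delta_id_id_iPhi_inv.
- exact: id_id_Delta_iPhi_inv.
Qed.

Lemma tsum_pentagon2 (F : H -> H -> H -> H -> W) : quadlin F ->
  \tsum_(z1, z2, z3 <- iPhi) \tsum_(x1, x2, x3 <- iPhi)
  \tsum_(x21, x22 <- D x2) \tsum_(y1, y2, y3 <- iPhi)
    F (z1 * x1) (z2 * x21 * y1) (z3 * x22 * y2) (x3 * y3)
  = \tsum_(y1, y2, y3 <- iPhi) \tsum_(y11, y12 <- D y1)
    \tsum_(x1, x2, x3 <- iPhi) \tsum_(x31, x32 <- D x3)
      F (y11 * x1) (y12 * x2) (y2 * x31) (y3 * x32).
Proof.
move=> FL; pose G (x : H4) := \tsum_(a, b, c, d <- x) F a b c d.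
transitivity (G (tens_one iPhi * id_Delta_id D iPhi * one_tens iPhi)).
  rewrite /G /tens_one /one_tens /id_Delta_id /Delta_id.
  (* The occurrence lists pair each copy of [iPhi] in the sums with its copy in the product, so that
     every tensor enters both sides linearly. *)
  move: iPhi {1 3}iPhi {1 4}iPhi => u t s.
  ext s as z1 z2 z3; ext t as x1 x2 x3; ext u as y1 y2 y3; sweedler.
  by rewrite !mul1r !mulr1.
rewrite pentagon_form2 /G /Delta_id_id /id_id_Delta /id_Delta.
move: iPhi {1 3}iPhi => t s.
ext s as z1 z2 z3; ext t as x1 x2 x3; sweedler.
by [].
Qed.

(* [S c * alpha * d] absorbs a coproduct multiplied to [c ⊗ d] on the left, so
   the outer factor [id_Delta_id iPhi] of the pentagon reduces to its counit. *)
Lemma tsum_pentagon1 (F : H -> H -> H -> W) : trilin F ->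
  \tsum_(X1, X2, X3 <- Phi) \tsum_(x1, x2, x3 <- iPhi)
  \tsum_(x11, x12 <- D x1)
    F (X1 * x11) (S (X2 * x12) * alpha * (X3 * x2)) x3
  = \tsum_(x1, x2, x3 <- iPhi) \tsum_(X1, X2, X3 <- Phi)
    \tsum_(X31, X32 <- D X3)
      F X1 (S (x1 * X2) * alpha * (x2 * X31)) (x3 * X32).
Proof.
move=> FL.
pose G (x : H4) := \tsum_(a, b, c, d <- x) F a (S b * alpha * c) d.
transitivity (G (tens_one Phi * Delta_id_id D iPhi)).
  rewrite /G /tens_one /Delta_id_id; move: Phi iPhi => s t.
  ext s as X1 X2 X3; ext t as x1 x2 x3; sweedler.
  by rewrite !mul1r.
rewrite pentagon_form1.
pose E a d := \tsum_(x1, x2, x3 <- iPhi) \tsum_(X1, X2, X3 <- Phi)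
    \tsum_(X31, X32 <- D X3)
      F (a * X1) (S (x1 * X2) * alpha * (x2 * X31)) (d * (x3 * X32)).
have EL : bilin E by rewrite /E; lin_tac.
transitivity (\tsum_(y1, y2, y3 <- iPhi) eps y2 *: E y1 y3).
  rewrite /G /E /id_Delta_id /Delta_id /one_tens /id_id_Delta /id_Delta.
  move: Phi iPhi {1 3}iPhi => s t y.
  ext s as X1 X2 X3; ext t as x1 x2 x3; ext y as y1 y2 y3; eval_pure.
  ext (D X3) as X31 X32; eval_pure.
  rewrite -(tsum_alpha (f := fun m => F _ (S (x1 * X2) * m * (x2 * X31)) _));
    last lin_tac.
  by sweedler; rewrite mul1r antipodeM !mulrA.
rewrite tsum_eps_iPhi2 // /E.
move: Phi iPhi => s t.
ext s as X1 X2 X3; ext t as x1 x2 x3; sweedler.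
by rewrite !mul1r.
Qed.

(** The same absorption as in [tsum_pentagon1], for the form of the pentagon whose right side ends
    in [one_tens iPhi]. The first argument of [F] collapses to 1, which is what frees [b] from its
    left factor in [xiK]. *)
Lemma tsum_pentagon4 (F : H -> H -> H -> W) : trilin F ->
  \tsum_(X1, X2, X3 <- Phi) \tsum_(x1, x2, x3 <- iPhi)
  \tsum_(x11, x12 <- D x1) \tsum_(z1, z2, z3 <- iPhi)
  \tsum_(z31, z32 <- D z3)
    F (X1 * x11 * z1) (S (X2 * x12 * z2) * alpha * (X3 * x2 * z31)) (x3 * z32)
  = \tsum_(x1, x2, x3 <- iPhi) F 1 (S x1 * alpha * x2) x3.
Proof.
move=> FL.
pose G (x : H4) := \tsum_(a, b, c, d <- x) F a (S b * alpha * c) d.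
transitivity (G (tens_one Phi * Delta_id_id D iPhi * id_id_Delta D iPhi)).
  rewrite /G /tens_one /Delta_id_id /id_id_Delta /id_Delta.
  move: Phi iPhi {1 3}iPhi => s u t.
  ext s as X1 X2 X3; ext t as x1 x2 x3; ext u as z1 z2 z3; sweedler.
  by rewrite !mul1r.
rewrite pentagon_form4.
pose E a d := \tsum_(x1, x2, x3 <- iPhi) F a (S x1 * alpha * x2) (d * x3).
have EL : bilin E by rewrite /E; lin_tac.
transitivity (\tsum_(y1, y2, y3 <- iPhi) eps y2 *: E y1 y3).
  rewrite /G /E /id_Delta_id /Delta_id /one_tens.
  move: iPhi {1 3}iPhi => t y.
  ext t as x1 x2 x3; ext y as y1 y2 y3; eval_pure.
  (* Used from right to left: [eps y2] is expanded again into a coproduct of [y2] around [alpha]. *)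
  rewrite -(tsum_alpha (f := fun m => F _ (S x1 * m * x2) _)); last lin_tac.
  by sweedler; rewrite mulr1 antipodeM !mulrA.
rewrite tsum_eps_iPhi2 // /E; move: iPhi => t.
by ext t as x1 x2 x3; sweedler; rewrite mul1r.
Qed.

(** The expression [S c * alpha * d] now occupies the last two factors, where [id_id_Delta iPhi] has
    its coproduct, so this factor reduces to its counit. *)
Lemma tsum_pentagon3_alpha (F : H -> H -> H -> W) : trilin F ->
  \tsum_(X1, X2, X3 <- Phi) \tsum_(X11, X12 <- D X1)
  \tsum_(z1, z2, z3 <- iPhi) \tsum_(x1, x2, x3 <- iPhi)
  \tsum_(x21, x22 <- D x2)
    F (X11 * z1 * x1) (X12 * z2 * x21) (S (X2 * z3 * x22) * alpha * (X3 * x3))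
  = \tsum_(X1, X2, X3 <- Phi) F 1 X1 (S X2 * alpha * X3).
Proof.
move=> FL.
pose G (x : H4) := \tsum_(a, b, c, d <- x) F a b (S c * alpha * d).
transitivity (G (Delta_id_id D Phi * (tens_one iPhi * id_Delta_id D iPhi))).
  rewrite /G /tens_one /Delta_id_id /id_Delta_id /Delta_id.
  move: Phi iPhi {1 3}iPhi => s u t.
  ext s as X1 X2 X3; ext t as z1 z2 z3; ext u as x1 x2 x3; sweedler.
  by rewrite !mul1r !mulrA.
rewrite pentagon_form3.
pose E a b := \tsum_(X1, X2, X3 <- Phi) F a (b * X1) (S X2 * alpha * X3).
have EL : bilin E by rewrite /E; lin_tac.
transitivity (\tsum_(y1, y2, y3 <- iPhi) eps y3 *: E y1 y2).
  rewrite /G /E /id_id_Delta /id_Delta /one_tens; move: iPhi Phi => y s.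
  ext y as y1 y2 y3; ext s as X1 X2 X3; eval_pure.
  rewrite -(tsum_alpha (f := fun m => F _ _ (S X2 * m * X3))); last lin_tac.
  by sweedler; rewrite mulr1 antipodeM !mulrA.
rewrite tsum_eps_iPhi3 // /E; move: Phi => s.
by ext s as X1 X2 X3; sweedler; rewrite mul1r.
Qed.

(** Dually, [b * beta * S c] absorbs a coproduct multiplied to [b ⊗ c] on the right. The same form
    of the pentagon is therefore read backwards, where [id_Delta_id iPhi] is the rightmost
    factor. *)
Lemma tsum_pentagon3_beta (F : H -> H -> H -> W) : trilin F ->
  \tsum_(z1, z2, z3 <- iPhi) \tsum_(z31, z32 <- D z3)
  \tsum_(Z1, Z2, Z3 <- Phi)
    F z1 (z2 * Z1 * beta * S (z31 * Z2)) (z32 * Z3)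
  = \tsum_(Y1, Y2, Y3 <- Phi) \tsum_(Y11, Y12 <- D Y1)
    \tsum_(y1, y2, y3 <- iPhi)
      F (Y11 * y1) (Y12 * y2 * beta * S (Y2 * y3)) Y3.
Proof.
move=> FL.
pose G (x : H4) := \tsum_(a, b, c, d <- x) F a (b * beta * S c) d.
transitivity (G (id_id_Delta D iPhi * one_tens Phi)).
  rewrite /G /one_tens /id_id_Delta /id_Delta; move: Phi iPhi => s t.
  ext s as Z1 Z2 Z3; ext t as z1 z2 z3; sweedler.
  by rewrite mulr1.
rewrite -pentagon_form3.
pose E a d := \tsum_(Y1, Y2, Y3 <- Phi) \tsum_(Y11, Y12 <- D Y1)
    \tsum_(y1, y2, y3 <- iPhi)
      F (Y11 * y1 * a) (Y12 * y2 * beta * S (Y2 * y3)) (Y3 * d).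
have EL : bilin E by rewrite /E; lin_tac.
transitivity (\tsum_(x1, x2, x3 <- iPhi) eps x2 *: E x1 x3).
  rewrite /G /E /tens_one /Delta_id_id /id_Delta_id /Delta_id.
  move: Phi iPhi {2 3}iPhi => s t u.
  ext s as Y1 Y2 Y3; ext t as y1 y2 y3; ext u as x1 x2 x3; eval_pure.
  ext (D Y1) as Y11 Y12; eval_pure.
  rewrite -(tsum_beta (f := fun m => F _ (Y12 * y2 * m * S (Y2 * y3)) _));
    last lin_tac.
  by sweedler; rewrite mul1r !antipodeM !mulrA.
rewrite tsum_eps_iPhi2 // /E; move: Phi iPhi => s t.
by ext s as Y1 Y2 Y3; ext t as y1 y2 y3; sweedler; rewrite !mulr1.
Qed.

(** * Quasi-coassociativity combined with the antipode axioms *)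

(** Quasi-coassociativity moves the coproduct of [h] to the left of [Phi]. There [h21] and [h22]
    surround [alpha] and collapse, and the counit reassembles [h]. The next two lemmas are the
    variants for [iPhi] and for [beta]. *)
Lemma tsum_coassoc_Phi_alpha (F : H -> H -> W) h : bilin F ->
  \tsum_(X1, X2, X3 <- Phi) \tsum_(h1, h2 <- D h) \tsum_(h11, h12 <- D h1)
    F (X1 * h11) (S (X2 * h12) * alpha * (X3 * h2))
  = \tsum_(X1, X2, X3 <- Phi) F (h * X1) (S X2 * alpha * X3).
Proof.
move=> FL; rewrite (tsum_coassoc_Phi (F := fun a b c => F a (S b * alpha * c)));
  last lin_tac.
pose E a := \tsum_(X1, X2, X3 <- Phi) F (a * X1) (S X2 * alpha * X3).
(* Writing [h] as the sum of [eps h2 *: h1] lets the two sides be compared summand by summand over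
   [D h]. *)
rewrite -[RHS](tsum_counit_right (f := E)); last by rewrite /E; lin_tac.
apply: eq_tlift => h1 h2; rewrite /E.
ext Phi as X1 X2 X3; eval_pure.
rewrite -(tsum_alpha (f := fun m => F _ (S X2 * m * X3))); last lin_tac.
by sweedler; rewrite antipodeM !mulrA.
Qed.

Lemma tsum_coassoc_iPhi_alpha (F : H -> H -> W) h : bilin F ->
  \tsum_(x1, x2, x3 <- iPhi) \tsum_(h1, h2 <- D h) \tsum_(h21, h22 <- D h2)
    F (S (x1 * h1) * alpha * (x2 * h21)) (x3 * h22)
  = \tsum_(x1, x2, x3 <- iPhi) F (S x1 * alpha * x2) (h * x3).
Proof.
move=> FL; rewrite (tsum_coassoc_iPhi (F := fun a b c => F (S a * alpha * b) c));
  last lin_tac.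
pose E a := \tsum_(x1, x2, x3 <- iPhi) F (S x1 * alpha * x2) (a * x3).
rewrite -[RHS](tsum_counit_left (f := E)); last by rewrite /E; lin_tac.
apply: eq_tlift => h1 h2; rewrite /E.
ext iPhi as x1 x2 x3; eval_pure.
rewrite -(tsum_alpha (f := fun m => F (S x1 * m * x2) _)); last lin_tac.
by sweedler; rewrite antipodeM !mulrA.
Qed.

Lemma tsum_coassoc_Phi_beta (F : H -> H -> W) h : bilin F ->
  \tsum_(h1, h2 <- D h) \tsum_(h21, h22 <- D h2) \tsum_(Z1, Z2, Z3 <- Phi)
    F (h1 * Z1 * beta * S (h21 * Z2)) (h22 * Z3)
  = \tsum_(Z1, Z2, Z3 <- Phi) F (Z1 * beta * S Z2) (Z3 * h).
Proof.
move=> FL; rewrite -(tsum_coassoc_Phi (F := fun a b c => F (a * beta * S b) c));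
  last lin_tac.
pose E a := \tsum_(Z1, Z2, Z3 <- Phi) F (Z1 * beta * S Z2) (Z3 * a).
rewrite -[RHS](tsum_counit_left (f := E)); last by rewrite /E; lin_tac.
rewrite /E; ext Phi as Z1 Z2 Z3; ext (D h) as h1 h2; eval_pure.
rewrite -(tsum_beta (f := fun m => F (Z1 * m * S Z2) _)); last lin_tac.
by sweedler; rewrite antipodeM !mulrA.
Qed.

(** The components of [D x1] surround [beta] and collapse to [eps x1]. The counit condition then
    removes [iPhi], and the antipode axiom for [Phi] remains. *)
Lemma tsum_antipode_Phi (F : H -> H -> W) : bilin F ->
  \tsum_(X1, X2, X3 <- Phi) \tsum_(x1, x2, x3 <- iPhi)
  \tsum_(x11, x12 <- D x1)
    F (X1 * x11 * beta * (S (X2 * x12) * alpha * (X3 * x2))) x3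
  = F 1 1.
Proof.
move=> FL.
pose E a d := \tsum_(X1, X2, X3 <- Phi) F (X1 * beta * S X2 * alpha * X3 * a) d.
have EL : bilin E by rewrite /E; lin_tac.
transitivity (\tsum_(x1, x2, x3 <- iPhi) eps x1 *: E x2 x3).
  rewrite /E; move: Phi iPhi => s t.
  ext s as X1 X2 X3; ext t as x1 x2 x3; eval_pure.
  rewrite -(tsum_beta (f := fun m => F (X1 * m * S X2 * alpha * X3 * x2) _));
    last lin_tac.
  by sweedler; rewrite antipodeM !mulrA.
rewrite tsum_eps_iPhi1 // /E.
transitivity (F (\tsum_(X1, X2, X3 <- Phi) (X1 * beta * S X2 * alpha * X3)) 1);
  last by rewrite antipode_Phi.
rewrite [RHS](@lin_sum _ _ _ _ _ (fun z => F z 1)); last lin_tac.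
by apply: eq_tlift => X1 t; ext t as X2 X3; eval_pure; rewrite mulr1.
Qed.

End SweedlerRules.

(** * The action and product of [B^v] in terms of [kappa] *)

Section Isomorphism.
Variables (k : fieldType) (H : pzAlgType k) (Q : quasi_hopf H).
Variables (B : pzAlgType k) (v : H -> B).
Hypothesis vA : algebra_map v.
Local Notation D := (Delta Q).
Local Notation S := (antipode Q).
Local Notation eps := (eps Q).
Local Notation alpha := (alpha Q).
Local Notation beta := (beta Q).
Local Notation Phi := (Phi Q).
Local Notation iPhi := (iPhi Q).
Local Notation act := (Bv_act Q v).
Local Notation star := (Bv_mul Q v).

Let vM : {morph v : x y / x * y} := algebra_mapM vA.
Let v1 : v 1 = 1 := algebra_map1 vA.

Definition kappa (b : B) : B :=
  \tsum_(X1, X2, X3 <- Phi) (v X1 * b * v (S X2 * alpha * X3)).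

Lemma kappa_lin : lin kappa.
Proof. rewrite /kappa; lin_tac. Qed.

Lemma act_bilin : bilin act.
Proof. rewrite /Bv_act; lin_tac. Qed.

Lemma star_bilin : bilin star.
Proof. rewrite /Bv_mul; lin_tac. Qed.

(* [lin_map] finds the multilinearity of maps in the context. *)
Let kL := kappa_lin.
Let aL := act_bilin.
Let sL := star_bilin.

Lemma act_mul g h b : act (g * h) b = act g (act h b).
Proof.
by rewrite /Bv_act; sweedler; rewrite antipodeM !vM !mulrA.
Qed.

Lemma act1 b : act 1 b = b.
Proof.
rewrite /Bv_act Delta1 one_pure; eval_pure.
by rewrite antipode1 v1 mul1r mulr1.
Qed.

(** For an ordinary Hopf algebra ([Phi = 1], [alpha = 1]) [kappa] is the identity, and this is the
    cancellation of [S h2 * h3] in [v h1 * b * v (S h2) * v h3]. *)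
Lemma kappa_act h b :
  \tsum_(h1, h2 <- D h) (kappa (act h1 b) * v h2) = v h * kappa b.
Proof.
transitivity (\tsum_(X1, X2, X3 <- Phi) (v (h * X1) * b * v (S X2 * alpha * X3))).
  rewrite -(tsum_coassoc_Phi_alpha Q (F := fun a m => v a * b * v m)); last lin_tac.
  rewrite /kappa; ext Phi as X1 X2 X3; ext (D h) as h1 h2.
  by rewrite /Bv_act; sweedler; rewrite antipodeM !vM !mulrA.
by rewrite /kappa; ext Phi as X1 X2 X3; eval_pure; rewrite vM !mulrA.
Qed.

Lemma starE b c : star b c =
  \tsum_(x1, x2, x3 <- iPhi) (kappa (act x1 b) * v x2 * c * v (S x3)).
Proof.
transitivity (\tsum_(x1, x2, x3 <- iPhi) \tsum_(X1, X2, X3 <- Phi)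
    \tsum_(X31, X32 <- D X3)
      (v X1 * b * v (S (x1 * X2) * alpha * (x2 * X31)) * c * v (S (x3 * X32)))).
  rewrite /Bv_mul; ext Phi as X1 X2 X3; ext iPhi as x1 x2 x3.
  by sweedler; rewrite !mulrA.
(* This trades the coproduct of [X3] for one of [x1], the one contained in [act x1 b]. *)
rewrite -(tsum_pentagon1 Q (F := fun a m d => v a * b * v m * c * v (S d)));
  last lin_tac.
rewrite /kappa /Bv_act; ext Phi as X1 X2 X3; ext iPhi as x1 x2 x3.
by sweedler; rewrite antipodeM !vM !mulrA.
Qed.

(** Written with [starE], both sides are sums of values of the same [F], and they differ by
    quasi-coassociativity for [iPhi]. *)
Lemma act_star h b c :
  act h (star b c) = \tsum_(h1, h2 <- D h) star (act h1 b) (act h2 c).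
Proof.
pose F a d e := kappa (act a b) * v d * c * v (S e).
have FL : trilin F by rewrite /F; lin_tac.
transitivity (\tsum_(h1, h2 <- D h) \tsum_(h11, h12 <- D h1)
    \tsum_(x1, x2, x3 <- iPhi) F (h11 * x1) (h12 * x2) (h2 * x3)).
  rewrite {1}/Bv_act starE /F; ext iPhi as x1 x2 x3; ext (D h) as h1 h2.
  eval_pure; rewrite !mulrA -kappa_act; sweedler.
  by rewrite act_mul antipodeM !vM !mulrA.
rewrite -tsum_coassoc_iPhi //.
transitivity (\tsum_(h1, h2 <- D h) \tsum_(x1, x2, x3 <- iPhi)
    (kappa (act x1 (act h1 b)) * v x2 * act h2 c * v (S x3))).
  rewrite /F; ext iPhi as x1 x2 x3; ext (D h) as h1 h2; eval_pure.
  rewrite [act h2 c]/Bv_act; sweedler.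
  by rewrite act_mul antipodeM !vM !mulrA.
by apply: eq_tlift => h1 h2; rewrite starE.
Qed.

Lemma kappa_star b c :
  \tsum_(x1, x2, x3 <- iPhi) (kappa (star (act x1 b) (act x2 c)) * v x3)
  = kappa b * kappa c.
Proof.
pose F a d m := kappa (act a b) * v d * c * v m.
have FL : trilin F by rewrite /F; lin_tac.
transitivity (\tsum_(x1, x2, x3 <- iPhi) \tsum_(z1, z2, z3 <- iPhi)
    \tsum_(X1, X2, X3 <- Phi)
    (v X1 * (kappa (act z1 (act x1 b)) * v z2 * act x2 c * v (S z3))
     * v (S X2 * alpha * X3 * x3))).
  apply: eq_tlift => x1 w; apply: eq_tlift => x2 x3.
  rewrite starE {1}/kappa; ext iPhi as z1 z2 z3; ext Phi as X1 X2 X3; eval_pure.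
  by rewrite !vM !mulrA.
have := tsum_pentagon3_alpha Q FL; rewrite /F => LE; etransitivity; last first.
  etransitivity; first exact: LE.
  rewrite act1 {3}/kappa; ext Phi as X1 X2 X3; eval_pure.
  by rewrite !mulrA.
 move: Phi iPhi {1 4}iPhi => s u t.
ext s as X1 X2 X3; ext t as x1 x2 x3; ext u as z1 z2 z3; eval_pure.
(* Moving [v X1] inside [kappa] produces the coproduct of [X1] required by the pentagon. *)
rewrite !mulrA -kappa_act [act x2 c]/Bv_act; sweedler.
by rewrite !act_mul !antipodeM !vM !mulrA.
Qed.

(** * The two factors of [psi] and their commutation rules *)

Local Notation BH := (tensor_alg B H).

(** [jmap b] and [dmap h] turn out to be the images under [psi] of [b # 1] and of [v beta # h]. *)
Definition jmap (b : B) : BH :=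
  \tsum_(x1, x2, x3 <- iPhi) (kappa (act x1 b) * v x2) ⊗ x3.

Definition dmap (h : H) : BH := \tsum_(h1, h2 <- D h) v h1 ⊗ h2.

Let jL : lin jmap.
Proof. rewrite /jmap; lin_tac. Qed.

Let dL : lin dmap.
Proof. rewrite /dmap; lin_tac. Qed.

Lemma dmapM : {morph dmap : g h / g * h}.
Proof. by move=> g h; rewrite /dmap; sweedler; rewrite vM. Qed.

Lemma dmap_jmap h b :
  dmap h * jmap b = \tsum_(h1, h2 <- D h) (jmap (act h1 b) * dmap h2).
Proof.
pose F (a c e : H) : B ⊗ H := (kappa (act a b) * v c) ⊗ e.
have FL : trilin F by rewrite /F; lin_tac.
transitivity (\tsum_(h1, h2 <- D h) \tsum_(h11, h12 <- D h1)
    \tsum_(x1, x2, x3 <- iPhi) F (h11 * x1) (h12 * x2) (h2 * x3)).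
  rewrite /dmap /jmap /F; ext iPhi as x1 x2 x3; ext (D h) as h1 h2; eval_pure.
  rewrite mulrA -kappa_act; sweedler.
  by rewrite act_mul vM mulrA.
rewrite -tsum_coassoc_iPhi // /F /jmap /dmap.
ext iPhi as x1 x2 x3; ext (D h) as h1 h2; sweedler.
by rewrite act_mul vM mulrA.
Qed.

Lemma jmap_star b c :
  \tsum_(x1, x2, x3 <- iPhi) (jmap (star (act x1 b) (act x2 c)) * dmap x3)
  = jmap b * jmap c.
Proof.
pose F (a d e f : H) : B ⊗ H := (kappa (star (act a b) (act d c)) * v e) ⊗ f.
have FL : quadlin F by rewrite /F; lin_tac.
transitivity (\tsum_(y1, y2, y3 <- iPhi) \tsum_(y11, y12 <- D y1)
    \tsum_(x1, x2, x3 <- iPhi) \tsum_(x31, x32 <- D x3)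
      F (y11 * x1) (y12 * x2) (y2 * x31) (y3 * x32)).
  rewrite /jmap /dmap /F; move: iPhi {1 4}iPhi => s t.
  ext s as y1 y2 y3; ext t as x1 x2 x3; eval_pure; rewrite act_star; sweedler.
  by rewrite !act_mul vM mulrA.
rewrite -tsum_pentagon2 // /F.
transitivity (\tsum_(x1, x2, x3 <- iPhi) \tsum_(y1, y2, y3 <- iPhi)
    \tsum_(x21, x22 <- D x2) \tsum_(z1, z2, z3 <- iPhi)
      (kappa (star (act z1 (act x1 b)) (act z2 (act x21 (act y1 c)))) * v z3
       * v x22 * v y2) ⊗ (x3 * y3)).
  move: iPhi {2 3}iPhi {2 4}iPhi => s u t.
  ext s as z1 z2 z3; ext t as x1 x2 x3; ext u as y1 y2 y3; sweedler.
  by rewrite !act_mul !vM !mulrA.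
transitivity (\tsum_(x1, x2, x3 <- iPhi) \tsum_(y1, y2, y3 <- iPhi)
    \tsum_(x21, x22 <- D x2)
      (kappa (act x1 b) * kappa (act x21 (act y1 c)) * v x22 * v y2) ⊗ (x3 * y3)).
  apply: eq_tlift => x1 w; apply: eq_tlift => x2 x3.
  apply: eq_tlift => y1 w'; apply: eq_tlift => y2 y3; apply: eq_tlift => x21 x22.
  (* The inner sum over [z1, z2, z3] is that of [kappa_star] for [act x1 b] and
     [act x21 (act y1 c)]. *)
  by rewrite -kappa_star; ext iPhi as z1 z2 z3; eval_pure.
rewrite /jmap; move: iPhi {1 3}iPhi => s t.
ext t as x1 x2 x3; ext s as y1 y2 y3; eval_pure.
(* On the right, [v x2] coming from [jmap b] meets the [kappa] of [jmap c], and passing it through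
   restores [x21] and [x22]. *)
rewrite mulrA -[X in (X * v y2) ⊗ _]mulrA -kappa_act; sweedler.
by rewrite !mulrA.
Qed.

(** * Multiplicativity of [psi] *)

Lemma psi_simple_bilin : bilin (psi_simple Q v).
Proof. rewrite /psi_simple; lin_tac. Qed.

Lemma xi_simple_bilin : bilin (xi_simple Q v).
Proof. rewrite /xi_simple; lin_tac. Qed.

Let pL := psi_simple_bilin.
Let xL := xi_simple_bilin.

Lemma psi_lin : lin (psi Q v).
Proof. rewrite /psi; lin_tac. Qed.

Lemma xi_lin : lin (xi Q v).
Proof. rewrite /xi; lin_tac. Qed.

Let psL := psi_lin.
Let xiL := xi_lin.

Lemma psi_pure b h : psi Q v (b ⊗ h) = psi_simple Q v b h.
Proof. exact: tlift_pure. Qed.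

Lemma xi_pure b h : xi Q v (b ⊗ h) = xi_simple Q v b h.
Proof. exact: tlift_pure. Qed.

Lemma psi_simpleE b h : psi_simple Q v b h = jmap b * dmap h.
Proof.
rewrite /psi_simple /jmap /dmap /kappa /Bv_act.
ext Phi as X1 X2 X3; ext iPhi as x1 x2 x3; sweedler.
by rewrite antipodeM !vM !mulrA.
Qed.

Lemma Bv_smash_mul_bilin : bilin (Bv_smash_mul Q v).
Proof. rewrite /Bv_smash_mul /smash_mul; lin_tac. Qed.

Let smL := Bv_smash_mul_bilin.

Lemma psi_mul s t : psi Q v (Bv_smash_mul Q v s t) = psi Q v s * psi Q v t.
Proof.
ext s as b h; ext t as c g; rewrite !psi_pure !psi_simpleE.
rewrite /Bv_smash_mul /smash_mul; eval_pure.
transitivity (\tsum_(h1, h2 <- D h) \tsum_(x1, x2, x3 <- iPhi)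
    (jmap (star (act x1 b) (act x2 (act h1 c))) * dmap x3 * dmap h2 * dmap g)).
  ext iPhi as x1 x2 x3; ext (D h) as h1 h2; eval_pure.
  by rewrite psi_pure psi_simpleE act_mul // !dmapM // !mulrA.
rewrite mulrA -[jmap b * _ * _]mulrA dmap_jmap //.
transitivity (\tsum_(h1, h2 <- D h)
  (jmap b * (jmap (act h1 c) * dmap h2) * dmap g)); last first.
  by ext (D h) as h1 h2; eval_pure.
(* For fixed [h1, h2] the sum over [iPhi] is that of [jmap_star] for [b] and [act h1 c]. *)
apply: eq_tlift => h1 h2; rewrite mulrA -jmap_star //.
by ext iPhi as x1 x2 x3; eval_pure.
Qed.

Lemma psi_one : psi Q v (Bv_smash_one Q v) = 1.
Proof.
rewrite /Bv_smash_one /smash_one /Bv_one psi_pure /psi_simple Delta1 !one_pure.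
rewrite -v1 -(tsum_antipode_Phi Q (F := fun a e => v a ⊗ e)); last lin_tac.
ext Phi as X1 X2 X3; ext iPhi as x1 x2 x3; sweedler.
by rewrite !mulr1 !vM !mulrA.
Qed.

(** * The maps [psi] and [xi] are mutually inverse *)

(** The components of [D X3] surround [beta] and collapse. The counit condition removes [Phi] and
    leaves the antipode axiom for [iPhi]. This is the last reduction in [psiK]. *)
Lemma star_beta b : star b (v beta) = b.
Proof.
pose E (a c : H) := \tsum_(x1, x2, x3 <- iPhi)
  (v a * b * v (S (x1 * c) * alpha * x2 * beta * S x3)).
have EL : bilin E by rewrite /E; lin_tac.
transitivity (\tsum_(X1, X2, X3 <- Phi) eps X3 *: E X1 X2).
  rewrite /Bv_mul /E; ext Phi as X1 X2 X3; ext iPhi as x1 x2 x3; eval_pure.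
  rewrite -(tsum_beta Q (f := fun m =>
    v X1 * b * v (S (x1 * X2) * alpha * x2 * m * S x3))); last lin_tac.
  by sweedler; rewrite !antipodeM !vM !mulrA.
rewrite tsum_eps_Phi3 // /E.
transitivity (b * v (\tsum_(x1, x2, x3 <- iPhi)
  (S x1 * alpha * x2 * beta * S x3))); last by rewrite antipode_iPhi v1 mulr1.
by ext iPhi as x1 x2 x3; eval_pure; rewrite v1 mul1r mulr1.
Qed.

Lemma psiK : cancel (psi Q v) (xi Q v).
Proof.
move=> t; ext t as b h; rewrite psi_pure psi_simpleE.
pose T (z1 z2 z3 x1 x2 x31 x32 m n : H) : B ⊗ H :=
  (v z1 * kappa (act x1 b) * v (x2 * m * S (z2 * x31))) ⊗ (z3 * x32 * n).
transitivity (\tsum_(x1, x2, x3 <- iPhi) \tsum_(x31, x32 <- D x3)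
    \tsum_(z1, z2, z3 <- iPhi) \tsum_(h1, h2 <- D h)
    \tsum_(h21, h22 <- D h2) \tsum_(Z1, Z2, Z3 <- Phi)
    T z1 z2 z3 x1 x2 x31 x32 (h1 * Z1 * beta * S (h21 * Z2)) (h22 * Z3)).
  rewrite /T /xi /xi_simple /jmap /dmap.
  move: Phi iPhi {1 3}iPhi => r s t'.
  ext t' as x1 x2 x3; ext s as z1 z2 z3; ext r as Z1 Z2 Z3; sweedler.
  by rewrite !antipodeM !vM !mulrA.
pose F (a m e : H) : B ⊗ H := \tsum_(z1, z2, z3 <- iPhi)
  (v z1 * kappa (act a b) * v (m * S z2)) ⊗ (z3 * e * h).
have FL : trilin F by rewrite /F; lin_tac.
transitivity (\tsum_(x1, x2, x3 <- iPhi) \tsum_(x31, x32 <- D x3)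
    \tsum_(Z1, Z2, Z3 <- Phi)
    F x1 (x2 * Z1 * beta * S (x31 * Z2)) (x32 * Z3)).
  apply: eq_tlift => x1 w; apply: eq_tlift => x2 x3; apply: eq_tlift => x31 x32.
  transitivity (\tsum_(z1, z2, z3 <- iPhi) \tsum_(Z1, Z2, Z3 <- Phi)
    T z1 z2 z3 x1 x2 x31 x32 (Z1 * beta * S Z2) (Z3 * h)).
    apply: eq_tlift => z1 w'; apply: eq_tlift => z2 z3.
    (* The coproducts of [h] are absorbed by [beta], and [h] moves to the far right of the second
       factor. *)
    apply: (tsum_coassoc_Phi_beta Q (F := T z1 z2 z3 x1 x2 x31 x32)).
    by rewrite /T; lin_tac.
  rewrite /T /F; ext iPhi as z1 z2 z3; ext Phi as Z1 Z2 Z3; eval_pure.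
  by rewrite !antipodeM !mulrA.
rewrite tsum_pentagon3_beta // /F.
transitivity (\tsum_(y1, y2, y3 <- iPhi)
    (kappa (act y1 b) * v y2 * v beta * v (S y3)) ⊗ h).
  pose E (a c e : H) : B ⊗ H := \tsum_(y1, y2, y3 <- iPhi)
    (v a * kappa (act y1 b) * v (y2 * beta * S y3 * S c)) ⊗ (e * h).
  have EL : trilin E by rewrite /E; lin_tac.
  transitivity (\tsum_(z1, z2, z3 <- iPhi) \tsum_(Y1, Y2, Y3 <- Phi)
      E (z1 * Y1) (z2 * Y2) (z3 * Y3)).
    rewrite /E; move: Phi iPhi {2 3}iPhi => r s t'.
    ext r as Y1 Y2 Y3; ext t' as z1 z2 z3; ext s as y1 y2 y3; eval_pure.
    (* [kappa_act] gathers [Y11] and [Y12] into [v Y1] to the left of [kappa], next to [v z1]; all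
       components of [Phi] then stand next to those of [iPhi] and cancel. *)
    rewrite (vM z1 Y1) -[v z1 * v Y1 * _]mulrA -kappa_act //; sweedler.
    by rewrite act_mul // !antipodeM !vM !mulrA.
  rewrite tsum_iPhi_Phi // /E; ext iPhi as y1 y2 y3; eval_pure.
  by rewrite antipode1 v1 mulr1 !mul1r !vM !mulrA.
(* What remains in the first factor is [star b (v beta)] in the form given by [starE]. *)
rewrite -[in RHS](star_beta b) starE //.
by ext iPhi as x1 x2 x3; eval_pure.
Qed.

Lemma xiK : cancel (xi Q v) (psi Q v).
Proof.
move=> t; ext t as b h; rewrite xi_pure.
pose F (Z1 Z2 h1 h21 h22 Z31 Z32 a m e : H) : B ⊗ H :=
  (v a * b * v (Z1 * beta * S (h1 * Z2) * m * h21 * Z31)) ⊗ (e * h22 * Z32).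
transitivity (\tsum_(Z1, Z2, Z3 <- Phi) \tsum_(Z31, Z32 <- D Z3)
    \tsum_(h1, h2 <- D h) \tsum_(h21, h22 <- D h2)
    \tsum_(X1, X2, X3 <- Phi) \tsum_(x1, x2, x3 <- iPhi)
    \tsum_(x11, x12 <- D x1) \tsum_(z1, z2, z3 <- iPhi)
    \tsum_(z31, z32 <- D z3)
    F Z1 Z2 h1 h21 h22 Z31 Z32 (X1 * x11 * z1)
      (S (X2 * x12 * z2) * alpha * (X3 * x2 * z31)) (x3 * z32)).
  rewrite /F /psi /psi_simple /xi_simple.
  move: iPhi {1 4}iPhi => t' s; move: Phi {1 3}Phi => r u.
  ext u as Z1 Z2 Z3; ext r as X1 X2 X3; ext t' as x1 x2 x3; ext s as z1 z2 z3.
  by sweedler; rewrite !antipodeM !vM !mulrA.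
transitivity (\tsum_(Z1, Z2, Z3 <- Phi) \tsum_(Z31, Z32 <- D Z3)
    \tsum_(h1, h2 <- D h) \tsum_(h21, h22 <- D h2)
    \tsum_(x1, x2, x3 <- iPhi)
    F Z1 Z2 h1 h21 h22 Z31 Z32 1 (S x1 * alpha * x2) x3).
  apply: eq_tlift => Z1 w; apply: eq_tlift => Z2 Z3; apply: eq_tlift => Z31 Z32.
  apply: eq_tlift => h1 h2; apply: eq_tlift => h21 h22.
  by apply: tsum_pentagon4; rewrite /F; lin_tac.
pose G (Z1 Z2 Z31 Z32 m e : H) : B ⊗ H :=
  (b * v (Z1 * beta * S Z2 * m * Z31)) ⊗ (e * Z32).
transitivity (\tsum_(Z1, Z2, Z3 <- Phi) \tsum_(Z31, Z32 <- D Z3)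
    \tsum_(x1, x2, x3 <- iPhi) \tsum_(h1, h2 <- D h)
    \tsum_(h21, h22 <- D h2)
    G Z1 Z2 Z31 Z32 (S (x1 * h1) * alpha * (x2 * h21)) (x3 * h22)).
  rewrite /F /G; ext Phi as Z1 Z2 Z3; ext iPhi as x1 x2 x3; sweedler.
  by rewrite v1 mul1r !antipodeM !vM !mulrA.
pose E (a m e : H) : B ⊗ H := (b * v (a * beta * m)) ⊗ (h * e).
have EL : trilin E by rewrite /E; lin_tac.
transitivity (\tsum_(x1, x2, x3 <- iPhi) \tsum_(Z1, Z2, Z3 <- Phi)
    \tsum_(Z31, Z32 <- D Z3)
    E Z1 (S (x1 * Z2) * alpha * (x2 * Z31)) (x3 * Z32)).
  transitivity (\tsum_(Z1, Z2, Z3 <- Phi) \tsum_(Z31, Z32 <- D Z3)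
      \tsum_(x1, x2, x3 <- iPhi)
      G Z1 Z2 Z31 Z32 (S x1 * alpha * x2) (h * x3)).
    apply: eq_tlift => Z1 w; apply: eq_tlift => Z2 Z3; apply: eq_tlift => Z31 Z32.
    (* Now [alpha] absorbs the coproducts of [h], which moves to the left of the second factor. *)
    by apply: tsum_coassoc_iPhi_alpha; rewrite /G; lin_tac.
  rewrite /G /E; ext Phi as Z1 Z2 Z3; ext iPhi as x1 x2 x3; sweedler.
  by rewrite !antipodeM !vM !mulrA.
(* This puts a coproduct of [x1] around [beta], the situation that [tsum_antipode_Phi] reduces to
   1. *)
rewrite -tsum_pentagon1 // /E.
rewrite (tsum_antipode_Phi Q (F := fun a e => (b * v a) ⊗ (h * e))); last lin_tac.
by rewrite v1 !mulr1.
Qed.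

(** * Algebra axioms of the smash product and conclusion *)

Lemma Bv_smash_is_algebra :
  is_algebra (Bv_smash_mul Q v) (Bv_smash_one Q v).
Proof.
split.
- by move=> r s t; apply: (can_inj psiK); rewrite !psi_mul mulrA.
- by move=> s; apply: (can_inj psiK); rewrite psi_mul psi_one mul1r.
- by move=> s; apply: (can_inj psiK); rewrite psi_mul psi_one mulr1.
- exact: bilin_for Bv_smash_mul_bilin.
Qed.

End Isomorphism.

(* The domain of psi is the space of B^v # H, with the operations Bv_smash_mul
   and Bv_smash_one. *)
Theorem theorem5p4 (k : fieldType) (H : pzAlgType k) (Q : quasi_hopf H)
    (B : pzAlgType k) (v : H -> B) (v_algebra_map : algebra_map v) :
  [/\ linear (psi Q v) /\ (forall b h, psi Q v (b ⊗ h) = psi_simple Q v b h),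
      linear (xi Q v) /\ (forall b h, xi Q v (b ⊗ h) = xi_simple Q v b h),
      cancel (psi Q v) (xi Q v) /\ cancel (xi Q v) (psi Q v),
      is_algebra (Bv_smash_mul Q v) (Bv_smash_one Q v)
    & psi Q v (Bv_smash_one Q v) = 1 /\
      {morph psi Q v : s t / Bv_smash_mul Q v s t >-> s * t}].

Proof.
split.
- by split; [apply: psi_lin | apply: psi_pure].
- by split; [apply: xi_lin | apply: xi_pure].
- by split; [apply: psiK | apply: xiK].
- exact: Bv_smash_is_algebra.
- by split; [apply: psi_one | move=> s t; apply: psi_mul].
Qed.
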